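(* Let $\beta\ge 1$ be finite, let $X$ be a separable Banach space with topological dual $X'$, let $\boldsymbol\alpha=(\alpha_j)_{j\ge1}\in\ell^1(\mathbb N)$ with $\alpha_j\in[0,\infty)$ for all $j$, and let $g:U_{\boldsymbol\alpha}\to X$. Let $p\in(0,1)$ and $k:=\lceil \frac{1}{1-p}\rceil$. Suppose that: (1) for a.e. $\boldsymbol y\in U_{\boldsymbol\alpha}$, $\|g(\boldsymbol y)-g_s(\boldsymbol y)\|_X\to 0$ as $s\to\infty$; (2) there are a sequence $(\Theta_m)_{m\ge0}$ of nonnegative numbers and a sequence $\boldsymbol b=(b_j)_{j\ge1}\in\ell^p(\mathbb N)$ with $b_1\ge b_2\ge\cdots\ge0$ such that $g$ is continuously differentiable up to order $k+1$, with $$\|\partial^{\boldsymbol\nu}g(\boldsymbol y)\|_X\le \Theta_{|\boldsymbol\nu|}\,\boldsymbol b^{\boldsymbol\nu}\prod_{j\ge1}{\rm e}^{\alpha_j|y_j|}<\infty$$ for all $\boldsymbol y\in U_{\boldsymbol\alpha}$ and all $\boldsymbol\nu\in\mathcal F_k:=\{\boldsymbol\nu\in\mathbb N_0^{\mathbb N}:|\boldsymbol\nu|\le k+1\}$; and, in the case $\beta=1$, in addition $\alpha_j<1$ for all $j\in\mathbb N$. Then there exists a constant $C>0$, independent of the dimension $s$, such that for all $s\in\mathbb N$ $$\bigg\|\int_{\mathbb R^{\mathbb N}}(g(\boldsymbol y)-g_s(\boldsymbol y))\,\boldsymbol\mu_\beta({\rm d}\boldsymbol y)\bigg\|_X\le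 C s^{-\frac2p+1},$$ and, with the same constant $C$, for every $G\in X'$ and all $s\in\mathbb N$ $$\bigg|\int_{\mathbb R^{\mathbb N}}G(g(\boldsymbol y)-g_s(\boldsymbol y))\,\boldsymbol\mu_\beta({\rm d}\boldsymbol y)\bigg|\le C\|G\|_{X'}s^{-\frac2p+1}.$$
   Context: $\mathbb N=\{1,2,\dots\}$, $\mathbb N_0=\mathbb N\cup\{0\}$. For a nonnegative sequence $\boldsymbol\alpha\in\ell^1(\mathbb N)$, $U_{\boldsymbol\alpha}:=\{\boldsymbol y\in\mathbb R^{\mathbb N}:\sum_{j\ge1}\alpha_j|y_j|<\infty\}$. For a function $g$ on $U_{\boldsymbol\alpha}$ and $s\in\mathbb N$, $g_s(\boldsymbol y):=g(\boldsymbol y_{\le s},\mathbf 0):=g(y_1,\dots,y_s,0,0,\dots)$. For $\beta\ge1$, $\boldsymbol\mu_\beta:=\bigotimes_{j\ge1}\mathcal N_\beta(0,1)$ is the product probability measure on $\mathbb R^{\mathbb N}$, where $\mathcal N_\beta(0,1)$ is the univariate $\beta$-Gaussian distribution with density $\varphi_\beta(y):=\frac{1}{2\beta^{1/\beta}\Gamma(1+\frac1\beta)}{\rm e}^{-|y|^\beta/\beta}$, $y\in\mathbb R$. The set $U_{\boldsymbol\alpha}$ has $\boldsymbol\mu_\beta(U_{\boldsymbol\alpha})=1$, and integrals over $\mathbb R^{\mathbb N}$ of functions defined on $U_{\boldsymbol\alpha}$ are understood as integrals over $U_{\boldsymbol\alpha}$; integrals of $X$-valued functions are Bochner integrals. ''A.e.''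 refers to $\boldsymbol\mu_\beta$. For a multi-index $\boldsymbol\nu\in\mathbb N_0^{\mathbb N}$ with finite support, $|\boldsymbol\nu|:=\sum_{j\ge1}\nu_j$, $\boldsymbol b^{\boldsymbol\nu}:=\prod_{j\ge1}b_j^{\nu_j}$ with the convention $0^0:=1$, and $\partial^{\boldsymbol\nu}$ denotes the corresponding mixed partial derivative with respect to the variables $y_j$. *)

(* Defs.v *)
From HB Require Import structures.
From mathcomp Require Import all_boot all_order all_algebra finmap.
From mathcomp Require Import all_classical all_reals all_analysis.
Set Implicit Arguments.
Unset Strict Implicit.
Unset Printing Implicit Defensive.
Import Order.TTheory GRing.Theory Num.Theory.
Import numFieldNormedType.Exports.
Local Open Scope classical_set_scope.
Local Open Scope ring_scope.

(** Sequences are indexed from 0: the mathematical coordinate [y_j], [j >= 1],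
    is [y (j - 1)]. *)

(** ** Sequence spaces *)

Definition in_ell (R : realType) (p : R) (a : nat -> R) : Prop :=
  (\sum_(0 <= j <oo) (`|a j| `^ p)%:E < +oo)%E.

Definition Uset (R : realType) (alpha : nat -> R) : set (nat -> R) :=
  [set y | (\sum_(0 <= j <oo) (alpha j * `|y j|)%:E < +oo)%E].

Definition truncate (R : realType) (s : nat) (y : nat -> R) : nat -> R :=
  fun j => if (j < s)%N then y j else 0.

(** The infinite product [prod_j exp (alpha_j |y_j|)]; for [alpha >= 0] its
    partial products are nondecreasing, so it converges in [[1, +oo]]. *)
Definition exp_weight (R : realType) (alpha y : nat -> R) : \bar R :=
  limn (fun n => (\prod_(j < n) expR (alpha j * `|y j|))%:E).

(** ** Multi-indices and partial derivatives *)

Definition multi_index := {fsfun nat -> nat with 0%N}.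

Definition mi_order (nu : multi_index) : nat :=
  (\sum_(j <- finsupp nu) nu j)%N.

Definition mi_pow (R : realType) (b : nat -> R) (nu : multi_index) : R :=
  \prod_(j <- finsupp nu) b j ^+ nu j.

Definition partial (R : realType) (X : normedModType R) (j : nat)
    (g : (nat -> R) -> X) : (nat -> R) -> X :=
  fun y => derive1 (fun t : R => g [eta y with j |-> t]) (y j).

Definition iter_partial (R : realType) (X : normedModType R) (js : seq nat)
    (g : (nat -> R) -> X) : (nat -> R) -> X :=
  foldr (fun j h => partial j h) g js.

Definition mixed_partial (R : realType) (X : normedModType R)
    (nu : multi_index) (g : (nat -> R) -> X) : (nat -> R) -> X :=
  iter_partial (flatten [seq nseq (nu j) j | j <- finsupp nu]) g.

Definition set_head (R : realType) (n : nat) (y : nat -> R) (t : 'rV[R]_n) :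
    nat -> R :=
  fun j => if insub j is Some i then t 0 i else y j.

(** Joint continuity in any finite number of variables, the others being
    frozen at a point of [D].  No topology on the sequence space is involved,
    and continuity on [D] for any topology inducing on the finite-dimensional
    coordinate slices a topology coarser than the Euclidean one implies this. *)
Definition finitely_continuous (R : realType) (X : normedModType R)
    (D : set (nat -> R)) (h : (nat -> R) -> X) : Prop :=
  forall (n : nat) (y : nat -> R), D y ->
    continuous (fun t : 'rV[R]_n => h (set_head y t)).

(** [D] is meant to be stable under changes of finitely many coordinates, so
    that only the values of [g] on [D] matter. *)
Definition continuously_differentiable (R : realType) (X : normedModType R)
    (D : set (nat -> R)) (m : nat) (g : (nat -> R) -> X) : Prop :=
  (forall js : seq nat, (size js < m)%N -> forall (j : nat) (y : nat -> R),
     D y -> derivable (fun t : R => iter_partial js g [eta y with j |-> t])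
                      (y j) 1) /\
  (forall js : seq nat, (size js <= m)%N ->
     finitely_continuous D (iter_partial js g)).

(** ** The product beta-Gaussian measure *)

Definition Gamma (R : realType) (x : R) : R :=
  Rintegral (@lebesgue_measure R) `]0, +oo[ (fun t => t `^ (x - 1) * expR (- t)).

Definition beta_gauss_pdf (R : realType) (beta y : R) : R :=
  (2 * beta `^ (beta^-1) * Gamma (1 + beta^-1))^-1
  * expR (- (`|y| `^ beta / beta)).

Definition beta_gauss (R : realType) (beta : R) (A : set R) : \bar R :=
  (\int[@lebesgue_measure R]_(y in A) (beta_gauss_pdf beta y)%:E)%E.

Definition cylinders (R : realType) : set (set (nat -> R)) :=
  \bigcup_(j in [set: nat])
    preimage_set_system setT (fun y : nat -> R => y j) (@measurable _ R).

(** [R^N] with the product sigma-algebra. *)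
Definition RN (R : realType) := g_sigma_algebraType (@cylinders R).

(** By the pi-lambda theorem at most one probability measure satisfies this. *)
Definition is_product_beta_gauss (R : realType) (beta : R)
    (mu : set (RN R) -> \bar R) : Prop :=
  forall (n : nat) (B : nat -> set R),
    (forall j, measurable (B j)) ->
    (mu [set y | forall j, (j < n)%N -> B j (y j)]
     = \prod_(j < n) beta_gauss beta (B j))%E.

(** ** Bochner integral *)

Definition simple_on d (T : measurableType d) (R : realType)
    (X : normedModType R) (mu : {measure set T -> \bar R}) (D : set T)
    (f : T -> X) : Prop :=
  [/\ finite_set (range f),
      forall x, measurable (D `&` f @^-1` [set x]) &
      forall x, x != 0 -> (mu (D `&` f @^-1` [set x]) < +oo)%E].

Definition simple_integral d (T : measurableType d) (R : realType)
    (X : normedModType R) (mu : {measure set T -> \bar R}) (D : set T)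
    (f : T -> X) : X :=
  \sum_(x \in range f) fine (mu (D `&` f @^-1` [set x])) *: x.

(** The almost everywhere convergence is strong measurability; it cannot be
    dropped, as the integral of a nonmeasurable nonnegative function is a lower
    integral. *)
Definition has_bochner_integral d (T : measurableType d) (R : realType)
    (X : normedModType R) (mu : {measure set T -> \bar R}) (D : set T)
    (f : T -> X) (v : X) : Prop :=
  exists f_ : nat -> T -> X,
    [/\ forall n, simple_on mu D (f_ n),
        {ae mu, forall x, D x -> f_ ^~ x @ \oo --> f x},
        (fun n => \int[mu]_(x in D) `|f x - f_ n x|%:E)%E @ \oo --> 0%E &
        (fun n => simple_integral mu D (f_ n)) @ \oo --> v].

Definition bochner_integrable d (T : measurableType d) (R : realType)
    (X : normedModType R) (mu : {measure set T -> \bar R}) (D : set T)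
    (f : T -> X) : Prop :=
  exists v, has_bochner_integral mu D f v.

Definition bochner_integral d (T : measurableType d) (R : realType)
    (X : normedModType R) (mu : {measure set T -> \bar R}) (D : set T)
    (f : T -> X) : X :=
  xget 0 [set v | has_bochner_integral mu D f v].

(** ** Banach spaces *)

Definition separable (T : topologicalType) : Prop :=
  exists2 S : set T, countable S & dense S.

Definition dual_norm (R : realType) (X : normedModType R) (G : X -> R) : R :=
  sup [set `|G x| | x in [set x : X | `|x| <= 1]].

(* Main.v *)
Require Import Defs.
From HB Require Import structures.
From mathcomp Require Import all_boot all_order all_algebra finmap.
From mathcomp Require Import all_classical all_reals all_analysis.
From mathcomp Require Import measurable_realfun.
From mathcomp Require Import ring lra.
Import Order.TTheory GRing.Theory Num.Theory.
Import numFieldNormedType.Exports.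
Set Implicit Arguments.
Unset Strict Implicit.
Unset Printing Implicit Defensive.
Local Open Scope classical_set_scope.
Local Open Scope ring_scope.

(** Coordinates are changed one at a time.  Write [g_s y] for
    [g (truncate s y)].  Then [g_n - g_s] is the sum over [s <= j < n] of the
    increments [g_(j+1) - g_j], and an increment only switches coordinate [j]
    from [0] to [y_j].  The law of [y_j] is symmetric and independent of the
    other coordinates, so the mean of the increment is half the mean of the
    second difference of [g] in direction [j], taken at [0] with steps [y_j] and
    [- y_j].  The second difference is at most a constant times [y_j ^ 2] times
    the supremum of the second pure partial derivative in direction [j], hence
    at most a constant times [b_j ^ 2 * y_j ^ 2 * prod_i exp (alpha_i |y_i|)].
    The expectations of these weights are bounded uniformly in [j], because each
    one-dimensional exponential moment is [1 + O(alpha_i)] and [alpha] is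
    summable.  So the increment has mean [O(b_j ^ 2)] ([mean_increment_le]), and
    the tail of [sum_j b_j ^ 2] from [s] on is [O(s ^ (1 - 2 / p))] for a
    nonincreasing sequence of [l^p] ([tail_sum_sq_le]).  The bound on
    [g_n - g_s] is uniform in [n], and dominated convergence carries it over to
    [g - g_s], with the infinite product of the exponentials as dominating
    function.

    All means are those of real functions [G (g y)], where [G] is a continuous
    linear functional.  The norm of a Bochner integral is recovered from a
    functional [G] of norm at most one that attains it
    ([exists_norming_functional], a form of the Hahn-Banach theorem).  The same
    functionals give the triangle inequality for integrals of simple functions,
    from which the Bochner integrability of norm-integrable functions into a
    separable space follows ([separable_bochner_integrable]).

    The function [g] is the almost everywhere limit of its truncations, which
    are measurable, but [g] itself may fail to be measurable for the product
    sigma-algebra.  Integrals of nonnegative functions are lower integrals, and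
    these ignore null sets even without measurability
    ([ge0_le_integral_off_null]); so [g - g_s] can be replaced by a function
    that vanishes on the exceptional null set and is measurable
    ([tame_difference]). *)

(** * Norming functionals *)

Section HahnBanach.
Context {R : realType} {X : normedModType R}.
Implicit Types (q : X -> R) (x y z v : X).

Definition sublinear q :=
  (forall x y, q (x + y) <= q x + q y) /\
  (forall (c : R) x, 0 < c -> q (c *: x) <= c * q x).

Lemma sublinear_ge0 q : sublinear q -> 0 <= q 0.
Proof. by move=> [/(_ 0 0)]; rewrite addr0 => h _; lra. Qed.

Lemma sublinear_geN q x : sublinear q -> - q (- x) <= q x.
Proof.
move=> hq; have := sublinear_ge0 hq; have := hq.1 x (- x).
by rewrite subrr => h1 h2; lra.
Qed.

Lemma sublinearZ q (c : R) x : sublinear q -> 0 < c -> q (c *: x) = c * q x.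
Proof.
move=> hq c0; apply/eqP; rewrite eq_le hq.2//= -ler_pdivlMl//.
have := hq.2 c^-1 (c *: x); rewrite invr_gt0 => /(_ c0).
by rewrite scalerA mulVf ?gt_eqF// scale1r.
Qed.

Lemma sublinear_norm : sublinear (fun x => `|x|).
Proof.
by split=> [x y|c x c0]; [exact: ler_normD|rewrite normrZ gtr0_norm].
Qed.

(** The value [q (x + t *: z) - t * q z] compares [q] along the ray from [x] in
    direction [z] with the linear growth [t * q z].  Its infimum is again
    sublinear, lies below [q], and is at most [q (x + z) - q z] at [x]; so a
    [q] that no sublinear functional improves is additive. *)
Definition slide q z x : R := inf [set q (x + t *: z) - t * q z | t in `[0, +oo[].

Section slide.
Variables (q : X -> R) (hq : sublinear q) (z : X).

Let slideZ (t : R) : 0 <= t -> q (t *: z) >= t * q z.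
Proof.
rewrite le_eqVlt => /predU1P[<-|t0]; last by rewrite sublinearZ.
by rewrite scale0r mul0r sublinear_ge0.
Qed.

Lemma slide_has_inf x : has_inf [set q (x + t *: z) - t * q z | t in `[0, +oo[].
Proof.
split; first by exists (q (x + 0 *: z) - 0 * q z), 0 => //; rewrite /= in_itv/= lexx.
exists (- q (- x)) => _ [t /= /[!in_itv]/= /andP[t0 _] <-].
have ht := slideZ t0.
have := hq.1 (- x) (x + t *: z); rewrite addrA addNr add0r => h; lra.
Qed.

Lemma slide_le (t : R) x : 0 <= t -> slide q z x <= q (x + t *: z) - t * q z.
Proof.
move=> t0; apply: ge_inf; first exact: (slide_has_inf _).2.
by exists t => //; rewrite /= in_itv/= andbT.
Qed.

Lemma slide_le_self x : slide q z x <= q x.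
Proof. by have := slide_le x (lexx 0); rewrite scale0r addr0 mul0r subr0. Qed.

Lemma le_slide (c : R) x : (forall t, 0 <= t -> c <= q (x + t *: z) - t * q z) ->
  c <= slide q z x.
Proof.
move=> h; apply: lb_le_inf; first exact: (slide_has_inf x).1.
by move=> _ [t /= /[!in_itv]/= /andP[t0 _] <-]; exact: h.
Qed.

Lemma sublinear_slide : sublinear (slide q z).
Proof.
split=> [x y|c x c0].
  rewrite -lerBlDr; apply: le_slide => t t0.
  rewrite lerBlDr -lerBlDl; apply: le_slide => s s0.
  rewrite lerBlDl; apply: le_trans (slide_le _ (addr_ge0 t0 s0)) _.
  have := hq.1 (x + t *: z) (y + s *: z).
  by rewrite addrACA -scalerDl => h; rewrite mulrDl; lra.
rewrite -ler_pdivrMl//; apply: le_slide => t t0; rewrite ler_pdivrMl//.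
apply: le_trans (slide_le _ (mulr_ge0 (ltW c0) t0)) _.
by rewrite mulrBr -scalerA -scalerDr (sublinearZ _ hq c0) mulrA.
Qed.

End slide.

(** Zorn's lemma applies because the pointwise infimum of a chain is sublinear;
    subadditivity holds since any two members of a chain have a smaller one
    among them, and the infimum is finite since a sublinear [a] satisfies
    [- a (- x) <= a x]. *)
Lemma minimal_sublinear (q0 : X -> R) : sublinear q0 ->
  exists q, [/\ sublinear q, forall x, q x <= q0 x &
    forall q', sublinear q' -> (forall x, q' x <= q x) -> q' = q].
Proof.
move=> hq0.
pose T := {q : X -> R | sublinear q /\ forall x, q x <= q0 x}.
pose below (a b : T) := `[< forall x, sval b x <= sval a x >].
have [|||A tot|[q [hq qq0]] qmin] := @Zorn T below.
- by move=> t; apply/asboolP.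
- move=> r s t /asboolP rs /asboolP st; apply/asboolP => x.
  exact: le_trans (st x) (rs x).
- move=> [s hs] [t ht] /asboolP/= st /asboolP/= ts; apply: eq_exist => /=.
  by apply/funext => x; apply/eqP; rewrite eq_le st ts.
- have [[a0 Aa0]|A0] := pselect (exists a, A a); last first.
    by exists (exist _ q0 (conj hq0 (fun x => lexx _))) => s As; case: A0; exists s.
  pose E x := [set sval a x | a in A].
  have Einf x : has_inf (E x).
    split; first by exists (sval a0 x), a0.
    exists (- q0 (- x)) => _ [a Aa <-].
    rewrite (le_trans _ (sublinear_geN x (svalP a).1))// lerN2.
    exact: (svalP a).2.
  have infE a x : A a -> inf (E x) <= sval a x.
    by move=> Aa; apply: ge_inf; [exact: (Einf x).2|exists a].
  have hE : sublinear (fun x => inf (E x)).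
    split=> [x y|c x c0].
      rewrite -lerBlDr; apply: lb_le_inf (Einf x).1 _ => _ [a Aa <-].
      rewrite lerBlDr -lerBlDl; apply: lb_le_inf (Einf y).1 _ => _ [b Ab <-].
      rewrite lerBlDl; have [/asboolP ab|/asboolP ab] := tot _ _ Aa Ab.
        apply: le_trans (infE b _ Ab) _; apply: le_trans ((svalP b).1.1 _ _) _.
        by rewrite lerD2r; exact: ab.
      apply: le_trans (infE a _ Aa) _; apply: le_trans ((svalP a).1.1 _ _) _.
      by rewrite lerD2l; exact: ab.
    rewrite -ler_pdivrMl//; apply: lb_le_inf (Einf x).1 _ => _ [a Aa <-].
    rewrite ler_pdivrMl//; apply: le_trans (infE a _ Aa) _.
    exact: (svalP a).1.2.
  have Eq0 x : inf (E x) <= q0 x.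
    exact: le_trans (infE a0 x Aa0) ((svalP a0).2 x).
  exists (exist _ (fun x => inf (E x)) (conj hE Eq0) : T) => a Aa; apply/asboolP => x /=.
  exact: infE.
exists q; split => // q' hq' q'q.
have q'q0 x : q' x <= q0 x by exact: le_trans (q'q x) (qq0 x).
have := qmin (exist _ q' (conj hq' q'q0) : T).
by move=> /(_ _)/(congr1 sval)/= -> //; exact/asboolP.
Qed.

(** A minimal sublinear functional [q] below the slide of the norm along [v] is
    linear.  It is dominated by the norm, and [q (- v) <= - `|v|] because the
    slide at [- v] is at most its value [`|0| - `|v|] at [t = 1]. *)
Theorem exists_norming_functional v :
  exists G : {linear X -> R^o},
    [/\ continuous G, forall x, `|G x| <= `|x| & G v = `|v|].
Proof.
have [q [hq qle qmin]] := minimal_sublinear (sublinear_slide sublinear_norm v).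
have qD x z : q (x + z) = q x + q z.
  apply/eqP; rewrite eq_le hq.1/=.
  have := qmin _ (sublinear_slide hq z) (slide_le_self hq z).
  move=> /(congr1 (@^~ x)) /= qx.
  have := slide_le hq z x (ler01 : 0 <= 1 :> R).
  by rewrite qx scale1r mul1r => h; lra.
have q0 : q 0 = 0 by have := qD 0 0; rewrite addr0 => h; lra.
have qN x : q (- x) = - q x by have := qD x (- x); rewrite subrr q0 => h; lra.
have qZ (c : R) x : q (c *: x) = c * q x.
  have [c0|c0|<-] := ltgtP 0 c; first exact: sublinearZ.
  - have Nc0 : 0 < - c by rewrite oppr_gt0.
    have := sublinearZ x hq Nc0.
    by rewrite scaleNr qN => h; lra.
  - by rewrite scale0r mul0r.
have lq : linear (q : X -> R^o) by move=> c x y; rewrite qD qZ.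
have qnorm x : q x <= `|x|.
  exact: le_trans (qle x) (slide_le_self sublinear_norm v x).
pose G : {linear X -> R^o} := HB.pack (q : X -> R^o)
  (GRing.isLinear.Build _ _ _ _ (q : X -> R^o) lq).
have Gnorm x : `|G x| <= `|x|.
  by rewrite ler_norml qnorm andbT lerNl -qN -(normrN x).
exists G; split => //.
  apply: bounded_linear_continuous; apply/linear_boundedP.
  exists 1; split => // r r1 x; apply: le_trans (Gnorm x) _.
  by rewrite ler_peMl// ltW.
apply/eqP; rewrite eq_le; apply/andP; split; first exact: qnorm.
have := slide_le sublinear_norm v (- v) (ler01 : 0 <= 1 :> R).
move=> /(le_trans (qle (- v))); rewrite scale1r addNr normr0 mul1r qN => h.
by rewrite -lerN2 -[X in _ <= X]add0r.
Qed.

End HahnBanach.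

Section DualNorm.
Context {R : realType} {X : normedModType R}.
Variables (G : {linear X -> R^o}).
Hypothesis cG : continuous G.

Let has_sup_dual_norm : has_sup [set `|G x : R| | x in [set x : X | `|x| <= 1]].
Proof.
split; first by exists `|G 0|, 0 => //=; rewrite normr0.
have /linear_boundedP/pinfty_ex_gt0[r r0 Gr] :=
  @continuous_linear_bounded _ _ _ 0 G (@cG 0).
exists r => _ [x /= x1 <-]; apply: le_trans (Gr x) _.
by rewrite ler_piMr// ltW.
Qed.

Lemma dual_norm_ge0 : 0 <= dual_norm G.
Proof.
apply: le_trans (normr_ge0 (G 0 : R)) _.
by apply: ub_le_sup has_sup_dual_norm.2 _ _; exists 0 => //=; rewrite normr0.
Qed.

Lemma dual_norm_le x : `|G x| <= dual_norm G * `|x|.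
Proof.
have [->|x0] := eqVneq x 0; first by rewrite linear0 !normr0 mulr0.
have nx0 : 0 < `|x| by rewrite normr_gt0.
rewrite -ler_pdivrMr//.
have -> : `|G x| / `|x| = `|G (`|x|^-1 *: x) : R|.
  by rewrite linearZ normrM mulrC ger0_norm ?invr_ge0.
apply: ub_le_sup; first exact: has_sup_dual_norm.2.
by exists (`|x|^-1 *: x) => //=; rewrite normrZ ger0_norm ?invr_ge0// mulVf ?gt_eqF.
Qed.

End DualNorm.

(** * Integrals of functions that need not be measurable *)

Section IntegralWithoutMeasurability.
Local Open Scope ereal_scope.
Context d (T : measurableType d) (R : realType).
Variables (mu : {measure set T -> \bar R}) (N : set T).
Hypotheses (mN : measurable N) (N0 : mu N = 0).
Implicit Types (D : set T) (f : T -> \bar R).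

Import HBNNSimple.

(** The integral of a nonnegative function is the supremum of the integrals of
    the simple functions below it.  Such a simple function can be set to zero on
    [N] without changing its integral, after which it lies below [f2]. *)
Lemma ge0_le_integral_off_null D f1 f2 :
  (forall x, D x -> 0 <= f1 x) -> (forall x, D x -> 0 <= f2 x) ->
  (forall x, D x -> ~ N x -> f1 x <= f2 x) ->
  \int[mu]_(x in D) f1 x <= \int[mu]_(x in D) f2 x.
Proof.
move=> f10 f20 f12; rewrite integral_mkcond [leRHS]integral_mkcond.
rewrite ge0_integralTE; last exact: erestrict_ge0.
rewrite ge0_integralTE; last exact: erestrict_ge0.
apply: ge_ereal_sup => _ [phi phif1 <-]; apply: le_ereal_sup_tmp.
have mNC := measurableC mN.
exists (sintegral mu (proj_nnsfun phi mNC)).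
  exists (proj_nnsfun phi mNC) => // x.
  have -> : proj_nnsfun phi mNC x = (phi \_ (~` N)) x by rewrite mrestrict.
  rewrite [in X in (X <= _)%E]patchE.
  case: ifPn => [/set_mem Nx|_]; last exact: erestrict_ge0.
  apply: le_trans (phif1 x) _; rewrite !patchE; case: ifPn => // /set_mem Dx.
  exact: f12.
rewrite -!integralT_nnsfun (@ge0_ae_eq_integral _ _ _ mu _
  (fun x => (phi x)%:E) (fun x => (proj_nnsfun phi mNC x)%:E))//.
- exact/measurable_EFinP/measurable_funP.
- exact/measurable_EFinP/measurable_funP.
- by move=> x _; rewrite lee_fin.
- by move=> x _; rewrite lee_fin.
exists N; split => // x /= xN; apply: contrapT => Nx; apply: xN => _ /=.
by rewrite mindicE mem_set ?mulr1.
Qed.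

Lemma ge0_eq_integral_off_null D f1 f2 :
  (forall x, D x -> 0 <= f1 x) -> (forall x, D x -> 0 <= f2 x) ->
  (forall x, D x -> ~ N x -> f1 x = f2 x) ->
  \int[mu]_(x in D) f1 x = \int[mu]_(x in D) f2 x.
Proof.
move=> f10 f20 f12; apply/eqP; rewrite eq_le.
by rewrite !ge0_le_integral_off_null// => x Dx Nx; rewrite f12.
Qed.

Lemma eq_integral_off_null D f1 f2 :
  (forall x, D x -> ~ N x -> f1 x = f2 x) ->
  \int[mu]_(x in D) f1 x = \int[mu]_(x in D) f2 x.
Proof.
move=> f12; rewrite integralE [RHS]integralE.
congr (_ - _); apply: ge0_eq_integral_off_null => // x Dx Nx.
  by rewrite !funeposE f12.
by rewrite !funenegE f12.
Qed.

End IntegralWithoutMeasurability.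

Lemma ge0_le_lower_integral d (T : measurableType d) (R : realType)
    (mu : {measure set T -> \bar R}) (D : set T) (f1 f2 : T -> \bar R) :
  (forall x, D x -> 0 <= f1 x)%E -> (forall x, D x -> f1 x <= f2 x)%E ->
  (\int[mu]_(x in D) f1 x <= \int[mu]_(x in D) f2 x)%E.
Proof.
move=> f10 f12; apply: (ge0_le_integral_off_null measurable0 (measure0 mu)) => //.
  by move=> x Dx; exact: le_trans (f10 x Dx) (f12 x Dx).
by move=> x Dx _; exact: f12.
Qed.

(** * Bochner integrals *)

(** The dominating sequence is extended-real because it will be a sequence of
    lower integrals, whose finiteness is only known near the limit. *)
Lemma cvg_of_dominated_dist (R : realType) (u : nat -> R) (r : R)
    (I : nat -> \bar R) :
  (forall n, `|r - u n|%:E <= I n)%E -> I @ \oo --> 0%E -> u @ \oo --> r.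
Proof.
move=> uI I0; apply/cvgrPdist_lt => e e0.
have : (fun n => `|r - u n|%:E) @ \oo --> 0%E.
  apply: (squeeze_cvge _ (@cvg_cst _ _ _ _ _) I0).
  by apply: nearW => n; rewrite lee_fin normr_ge0 uI.
move=> /fine_cvg/cvgrPdist_lt/(_ e e0); apply: filterS => n /=.
by rewrite sub0r normrN normr_id.
Qed.

Section Bochner.
Context d (T : measurableType d) (R : realType) (X : normedModType R).
Variables (mu : {finite_measure set T -> \bar R}) (D : set T).
Hypothesis mD : measurable D.

Section simple.
Variables (G : {linear X -> R^o}) (f : T -> X) (sf : simple_on mu D f).

Let A x := D `&` f @^-1` [set x].

Let mA x : measurable (A x). Proof. by case: sf => _ mf _; exact: mf. Qed.

Let indicE y : D y ->
  (G (f y))%:E = (\sum_(x <- fset_set (range f)) (G x)%:E * (\1_(A x) y)%:E)%E.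
Proof.
case: sf => fin _ _ Dy.
have fyr : f y \in fset_set (range f) by rewrite in_fset_set// inE; exists y.
rewrite (big_rem (f y))//= big1_seq ?adde0; last first.
  move=> x /=; rewrite mem_rem_uniq ?fset_uniq// inE => /andP[xy _].
  rewrite indicE memNset ?mule0// => -[_ /= fyx].
  by move: xy; rewrite fyx eqxx.
by rewrite indicE mem_set ?mule1.
Qed.

Let int_indic x : mu.-integrable D (fun y => (G x)%:E * (\1_(A x) y)%:E)%E.
Proof.
apply: integrableZl => //; apply: (integrableS measurableT) => //.
exact: integrable_indic.
Qed.

Lemma integrable_linear_simple : mu.-integrable D (fun y => (G (f y))%:E).
Proof.
apply: (eq_integrable mD (fun y =>
  \sum_(x <- fset_set (range f)) (G x)%:E * (\1_(A x) y)%:E)%E).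
  by move=> y /set_mem Dy; rewrite indicE.
exact: integrable_sum.
Qed.

Lemma integral_linear_simple :
  (\int[mu]_(y in D) (G (f y))%:E = (G (simple_integral mu D f))%:E)%E.
Proof.
case: (sf) => fin _ _.
rewrite (eq_integral (fun y =>
  \sum_(x <- fset_set (range f)) (G x)%:E * (\1_(A x) y)%:E)%E); last first.
  by move=> y /set_mem Dy; rewrite indicE.
rewrite integral_sum// /simple_integral fsbig_finite//= linear_sum -sumEFin.
apply: eq_bigr => x _; rewrite integralZl//; last first.
  by apply: (integrableS measurableT) => //; exact: integrable_indic.
rewrite integral_indic// linearZ/= EFinM muleC; congr (_ * _)%E.
have -> : A x `&` D = A x by apply/setIidl => y [].
rewrite fineK //; apply: fin_num_measure; exact: mA.
Qed.

End simple.

(** The distance to a simple function enters the definition through a lower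
    integral, so modification on a null set is harmless even if it destroys
    measurability. *)
Lemma has_bochner_integral_off_null (N : set T) (f f' : T -> X) v :
  measurable N -> mu N = 0%E -> (forall x, D x -> ~ N x -> f x = f' x) ->
  has_bochner_integral mu D f v -> has_bochner_integral mu D f' v.
Proof.
move=> mN N0 ff' [f_ [sf aef intf v_]]; exists f_; split => //.
  have aeN : {ae mu, forall x, ~ N x} by exists N; split => // x /= /contrapT.
  by apply: filterS2 aeN aef => x Nx cvf Dx; rewrite -ff'//; exact: cvf.
have -> // : (fun n => \int[mu]_(x in D) `|f' x - f_ n x|%:E)%E =
          (fun n => \int[mu]_(x in D) `|f x - f_ n x|%:E)%E.
apply/funext => n; apply: (ge0_eq_integral_off_null mN N0) => // x Dx Nx.
by rewrite ff'.
Qed.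

Lemma integral_linear_bochner (G : {linear X -> R^o}) (f : T -> X) v :
  (forall x, `|G x| <= `|x|) ->
  mu.-integrable D (fun x => (G (f x))%:E) ->
  has_bochner_integral mu D f v ->
  (\int[mu]_(x in D) (G (f x))%:E = (G v)%:E)%E.
Proof.
move=> GK iG [f_ [sf aef intf v_]].
rewrite -(fineK (integrable_fin_num mD iG)); congr (_%:E).
set r := fine _.
have rE : (\int[mu]_(x in D) (G (f x))%:E)%E = r%:E.
  by rewrite fineK//; exact: integrable_fin_num.
pose S n := simple_integral mu D (f_ n).
have dist n : (`|r - G (S n)|%:E <= \int[mu]_(x in D) `|f x - f_ n x|%:E)%E.
  rewrite -abse_EFin EFinB -rE -integral_linear_simple//.
  rewrite -integralB//; last exact: integrable_linear_simple.
  apply: le_trans (le_abse_integral _ _ _) _ => //.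
    apply: (measurable_int mu); apply: integrableB => //.
    exact: integrable_linear_simple.
  apply: ge0_le_lower_integral => // x Dx.
  by rewrite /= lee_fin -linearB; exact: GK.
have GSr : (fun n => G (S n)) @ \oo --> (r : R^o).
  apply: (cvg_of_dominated_dist dist intf).
have GSv : (fun n => G (S n)) @ \oo --> (G v : R^o).
  apply/cvgrPdist_lt => e e0; move: v_ => /cvgrPdist_lt/(_ e e0).
  apply: filterS => n; apply: le_lt_trans.
  by rewrite -linearB; exact: GK.
exact: (cvg_unique _ GSr GSv).
Qed.

End Bochner.

Section BochnerExistence.
Context d (T : measurableType d) (R : realType) (X : completeNormedModType R).
Variables (mu : {finite_measure set T -> \bar R}) (D : set T).
Hypothesis mD : measurable D.
Variable f : T -> X.
Hypothesis mf : forall x : X, measurable_fun D (fun y => `|f y - x|).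

Section nearest.
Variable xs : nat -> X.

(** [nearest n y] is the point closest to [f y] among [0] and the first [n]
    terms of [xs].  Starting from [0] gives the domination
    [`|f y - nearest n y| <= `|f y|], and updating one point at a time keeps the
    level sets measurable as soon as the distances to fixed points are. *)
Fixpoint nearest (n : nat) (y : T) : X :=
  if n is m.+1 then
    if `|f y - xs m| < `|f y - nearest m y| then xs m else nearest m y
  else 0.

Lemma nearest_distS n y :
  `|f y - nearest n.+1 y| = Num.min `|f y - xs n| `|f y - nearest n y|.
Proof. by rewrite /=; case: ltP. Qed.

Lemma nearest_dist_le n y : `|f y - nearest n y| <= `|f y|.
Proof.
elim: n => [|n ih]; first by rewrite subr0.
by rewrite nearest_distS ge_min ih orbT.
Qed.

Lemma nearest_dist_xs m n y : (m < n)%N ->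
  `|f y - nearest n y| <= `|f y - xs m|.
Proof.
elim: n => // n ih; rewrite ltnS leq_eqVlt nearest_distS ge_min.
by case/predU1P => [->|/ih ->]; rewrite ?lexx ?orbT.
Qed.

Lemma finite_range_nearest n : finite_set (range (nearest n)).
Proof.
elim: n => [|n ih].
  by apply: (sub_finite_set _ (finite_set1 (0 : X))) => _ [y _ <-].
apply: (@sub_finite_set _ _ (range (nearest n) `|` [set xs n])).
  move=> _ [y _ <-] /=; case: ifP => _; [by right|by left; exists y].
by rewrite finite_setU; split.
Qed.

Lemma measurable_nearest n :
  measurable_fun D (fun y => `|f y - nearest n y|) /\
  forall P : set X, measurable (D `&` nearest n @^-1` P).
Proof.
elim: n => [|n [mdist mP]].
  split=> [|P]; first exact: mf.
  have [P0|P0] := pselect (P 0).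
    rewrite (_ : _ `&` _ = D)//; apply/setIidl => y _; exact: P0.
  by rewrite (_ : _ `&` _ = set0)// -subset0 => y [].
split.
  under eq_fun do rewrite nearest_distS.
  exact: measurable_minr.
move=> P.
pose E := D `&` [set y | `|f y - xs n| < `|f y - nearest n y|].
have mE : measurable E.
  have : measurable_fun D (fun y => `|f y - xs n| < `|f y - nearest n y|).
    exact: measurable_fun_ltr.
  by move=> /(_ mD [set true]); exact.
have -> : D `&` nearest n.+1 @^-1` P =
    (E `&` [set _ | P (xs n)]) `|` ((D `&` nearest n @^-1` P) `\` E).
  apply/seteqP; split => y /=.
    move=> [Dy]; case: ifPn => [lt Py|nlt Py]; [by left|right].
    by split => // -[_ /= lt]; rewrite lt in nlt.
  move=> [[[Dy ->]]//|[[Dy Py] nE]]; split => //.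
  by rewrite ifF//; apply/negP => lt; apply: nE.
apply: measurableU; last exact: measurableD.
have [Pn|Pn] := pselect (P (xs n)).
  by rewrite (_ : _ `&` _ = E)//; apply/setIidl => y _; exact: Pn.
by rewrite (_ : _ `&` _ = set0)// -subset0 => y [].
Qed.

Lemma simple_nearest n : simple_on mu D (nearest n).
Proof.
split; first exact: finite_range_nearest.
  by move=> x; exact: (measurable_nearest n).2.
move=> x _; rewrite ltey_eq fin_num_measure//.
exact: (measurable_nearest n).2.
Qed.

Hypothesis xs_dense : forall (x : X) e, 0 < e -> exists m, `|x - xs m| < e.
Hypothesis fint : (\int[mu]_(y in D) `|f y|%:E < +oo)%E.

Lemma nearest_cvg y : nearest ^~ y @ \oo --> f y.
Proof.
apply/cvgrPdist_lt => e e0; have [m xm] := xs_dense (f y) e0.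
exists m.+1 => // n /= mn; apply: le_lt_trans xm.
exact: nearest_dist_xs.
Qed.

Lemma nearest_dist_integral_cvg :
  (fun n => \int[mu]_(y in D) `|f y - nearest n y|%:E)%E @ \oo --> 0%E.
Proof.
have mnf : measurable_fun D (fun y => `|f y|).
  by under eq_fun do rewrite -(subr0 (f _)); exact: mf.
have [] := @dominated_convergence _ _ _ mu D mD
    (fun n y => `|f y - nearest n y|%:E) (cst 0%E) (fun y => `|f y|%:E).
- move=> n; apply/measurable_EFinP; exact: (measurable_nearest n).1.
- exact: measurable_cst.
- apply: aeW => y _; apply: cvg_EFin; first exact: nearW.
  apply/cvgrPdist_lt => e e0.
  have /cvgrPdist_lt/(_ e e0) := @nearest_cvg y.
  by apply: filterS => n /=; rewrite sub0r normrN normr_id.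
- apply/integrableP; split; first exact/measurable_EFinP.
  by under eq_integral do rewrite /= normr_id.
- apply: aeW => y n _ /=; rewrite normr_id lee_fin; exact: nearest_dist_le.
by move=> _ _; rewrite integral0.
Qed.

(** The triangle inequality for integrals of simple functions would require a
    common refinement of two partitions; a norming functional reduces it to real
    integrals instead. *)
Lemma simple_integral_nearest_dist n m :
  (`|simple_integral mu D (nearest n) - simple_integral mu D (nearest m)|%:E <=
   \int[mu]_(y in D) `|f y - nearest n y|%:E +
   \int[mu]_(y in D) `|f y - nearest m y|%:E)%E.
Proof.
set v := _ - _; have [G [_ Gle Gv]] := exists_norming_functional v.
have iG k := @integrable_linear_simple _ _ _ _ mu D mD G _ (simple_nearest k).
rewrite -Gv linearB EFinB -!integral_linear_simple//; try exact: simple_nearest.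
have md k : measurable_fun D (fun y => `|f y - nearest k y|%:E).
  by apply/measurable_EFinP; exact: (measurable_nearest k).1.
rewrite -integralB// -ge0_integralD//.
apply: le_trans (lee_abs _) _.
apply: le_trans (le_abse_integral _ _ _) _ => //.
  by apply: (measurable_int mu); apply: integrableB.
apply: ge0_le_lower_integral => // y Dy.
rewrite /= -EFinD lee_fin -linearB (le_trans (Gle _))//.
rewrite (_ : _ - _ = (f y - nearest m y) - (f y - nearest n y)).
  by rewrite (le_trans (ler_normB _ _))// addrC.
by rewrite opprB [RHS]addrC addrA subrK.
Qed.

Lemma has_bochner_integral_nearest :
  exists v, has_bochner_integral mu D f v.
Proof.
suff /cauchy_cvgP/cvg_ex[v Sv] :
    cauchy (simple_integral mu D (nearest n) @[n --> \oo]).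
  exists v, nearest; split => //.
  - exact: simple_nearest.
  - by apply: aeW => y _; exact: nearest_cvg.
  - exact: nearest_dist_integral_cvg.
apply: cauchy_exP => e e0.
have e20 : 0 < e / 2 by rewrite divr_gt0.
have := nearest_dist_integral_cvg => /fine_cvgP[nfin].
move=> /cvgrPdist_lt/(_ _ e20) nlt.
have [M _ MP] := filterI nfin nlt.
exists (simple_integral mu D (nearest M)); exists M => // n /= Mn.
rewrite -ball_normE/=.
have [fM lM] := MP M (leqnn M); have [fn ln] := MP n Mn.
rewrite -lte_fin; apply: le_lt_trans (simple_integral_nearest_dist M n) _.
rewrite -(fineK fM) -(fineK fn) -EFinD lte_fin (splitr e).
move: lM ln; rewrite /= !sub0r !normrN => lM ln.
by apply: ltrD; [apply: le_lt_trans (ler_norm _) lM|apply: le_lt_trans (ler_norm _) ln].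
Qed.

End nearest.

Theorem separable_bochner_integrable : separable X ->
  (\int[mu]_(y in D) `|f y|%:E < +oo)%E -> bochner_integrable mu D f.
Proof.
move=> [S /countable_injP[code code_inj] dS] fint.
(* an enumeration of [S]; the value [0] at a number that codes no point of [S] is
   harmless *)
pose xs n := xget 0 [set x | S x /\ code x = n].
apply: (@has_bochner_integral_nearest xs) => // x e e0.
have [||z [xez Sz]] := dS (ball x e).
- by exists x; exact: ballxx.
- exact: ball_open.
exists (code z); rewrite /xs; case: xgetP => [z' _ [Sz' zz']|/(_ z)[]//].
have <- : z = z' by apply: code_inj; rewrite ?inE.
by move: xez; rewrite -ball_normE.
Qed.

End BochnerExistence.

(** * The product measure on sequences *)

Section IndicatorsToFunctions.
Local Open Scope ereal_scope.
Context d d' (T : measurableType d) (T' : measurableType d') (R : realType).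
Variables (mu : {measure set T -> \bar R}) (P : {measure set T' -> \bar R}).
Variables (Z : T -> T') (H : T -> R) (c : R).
Hypotheses (mZ : measurable_fun setT Z) (mH : measurable_fun setT H).
Hypotheses (H0 : forall x, (0 <= H x)%R) (c0 : (0 <= c)%R).
Hypothesis indicE : forall B, measurable B ->
  \int[mu]_x (H x * \1_B (Z x))%:E = c%:E * P B.

Import HBNNSimple.

Let nnsfunE (u : {nnsfun T' >-> R}) :
  \int[mu]_x (H x * u (Z x))%:E = c%:E * \int[P]_z (u z)%:E.
Proof.
rewrite integralT_nnsfun sintegralE ge0_mule_fsumr; last first.
  by move=> r; exact: nnsfun_mulemu_ge0.
transitivity (\int[mu]_x \sum_(r \in range u)
    (r%:E * (\1_(u @^-1` [set r]) (Z x))%:E * (H x)%:E)).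
  apply: eq_integral => x _; rewrite -ge0_mule_fsuml => [|r]; last first.
    exact: nnfun_muleindic_ge0.
  by rewrite EFinM muleC; congr (_ * _); rewrite fsumEFin// -fimfunE.
have mB r : measurable (u @^-1` [set r]) by exact: measurable_funPTI.
have m1 r : measurable_fun setT (fun x => \1_(u @^-1` [set r]) (Z x) : R).
  by apply: measurableT_comp => //; exact: measurable_indic.
rewrite ge0_integral_fsum//; last 2 first.
- move=> r; apply/measurable_EFinP; apply: measurable_funM => //.
  exact: measurable_funM.
- move=> r x _; apply: mule_ge0; last by rewrite lee_fin.
  exact: nnfun_muleindic_ge0.
apply: eq_fsbigr => r _.
have [r0|r0] := leP 0%R r; last first.
  rewrite (preimage_nnfun0 u r0) measure0 !mule0 integral0_eq// => x _.
  by rewrite indic0 !(mule0, mul0e).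
under eq_integral do rewrite -muleA [X in _ * X]muleC -EFinM.
under eq_integral do rewrite EFinM.
rewrite ge0_integralZl//.
- by rewrite indicE// muleCA.
- by apply/measurable_EFinP; exact: measurable_funM.
- by move=> x _; rewrite lee_fin mulr_ge0.
Qed.

(** If [H] and the events [Z^-1 B] satisfy the product rule, with [c] in the role
    of the mean of [H] and [P] in the role of the law of [Z], then so do [H] and
    [h \o Z] for every nonnegative [h]: the indicators extend to simple functions
    by additivity, and to [h] by monotone convergence.  The density formula is
    the case where [Z] is the identity and [H] a density of [P]. *)
Lemma integral_mul_comp (h : T' -> R) : measurable_fun setT h ->
  (forall z, (0 <= h z)%R) ->
  \int[mu]_x (H x * h (Z x))%:E = c%:E * \int[P]_z (h z)%:E.
Proof.
move=> mh h0.
have meh : measurable_fun setT (EFin \o h) by exact/measurable_EFinP.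
pose u := nnsfun_approx measurableT meh.
have cvu z : (u n z)%:E @[n --> \oo] --> (h z)%:E.
  by apply: (cvg_nnsfun_approx measurableT meh) => //= ? _; rewrite lee_fin.
have ndu z n m : (n <= m)%N -> (u n z <= u m z)%R.
  by move=> nm; exact/lefP/(nd_nnsfun_approx measurableT meh).
have lhs : \int[mu]_x (H x * u n (Z x))%:E @[n --> \oo] -->
    \int[mu]_x (H x * h (Z x))%:E.
  rewrite (eq_integral (fun x => limn (fun n => (H x * u n (Z x))%:E))).
    apply: cvg_monotone_convergence => //.
    - move=> n; apply/measurable_EFinP/measurable_funM => //.
      exact: measurableT_comp.
    - by move=> n x _; rewrite lee_fin mulr_ge0.
    - by move=> x _ n m nm; rewrite lee_fin ler_wpM2l// ndu.
  move=> x _; apply/esym/cvg_lim => //; rewrite EFinM.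
  by under eq_fun do rewrite EFinM; exact: cvgeZl.
have rhs : c%:E * \int[P]_z (u n z)%:E @[n --> \oo] -->
    c%:E * \int[P]_z (h z)%:E.
  apply: cvgeZl => //.
  rewrite (eq_integral (fun z => limn (fun n => (u n z)%:E))).
    apply: cvg_monotone_convergence => //.
    - by move=> n; exact/measurable_EFinP.
    - by move=> n x _; rewrite lee_fin.
    - by move=> x _ n m nm; rewrite lee_fin ndu.
  by move=> z _; apply/esym/cvg_lim.
have lhsE : (fun n => \int[mu]_x (H x * u n (Z x))%:E) =
    (fun n => c%:E * \int[P]_z (u n z)%:E).
  by apply/funext => n; exact: nnsfunE.
by rewrite lhsE in lhs; exact: cvg_unique lhs rhs.
Qed.

End IndicatorsToFunctions.

Section ProductMeasurable.
Context {R : realType}.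

Lemma measurable_coordinate j :
  measurable_fun [set: RN R] (fun y : RN R => (y : nat -> R) j).
Proof.
move=> _ B mB; apply: sub_sigma_algebra; exists j => //.
by exists B.
Qed.

Lemma measurable_to_RN d (T : measurableType d) (phi : T -> RN R) :
  (forall j, measurable_fun setT (fun x => (phi x : nat -> R) j)) ->
  measurable_fun setT phi.
Proof.
move=> mphi; apply: (@measurability _ _ _ (RN R) _ _ (@cylinders R)) => //.
move=> _ [C [j _ [B mB <-]] <-].
by rewrite !setTI; have := mphi j measurableT B mB; rewrite setTI.
Qed.

(** These sets are stable under intersection and generate the product
    sigma-algebra, so they determine a probability measure; the cylinders over
    one coordinate that define the sigma-algebra are not stable under
    intersection. *)
Definition rectangles : set (set (RN R)) :=
  [set A | exists n (B : nat -> set R), (forall j, measurable (B j)) /\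
     A = [set y : RN R | forall j, (j < n)%N -> B j ((y : nat -> R) j)]].

Lemma setI_closed_rectangles : setI_closed rectangles.
Proof.
move=> _ _ [n [B [mB ->]]] [m [C [mC ->]]].
exists (maxn n m), (fun j => (if (j < n)%N then B j else setT) `&`
                             (if (j < m)%N then C j else setT)).
split=> [j|].
  by apply: measurableI; case: ifP.
apply/seteqP; split => [y [By Cy] j _|y BCy]; first split.
- by case: ifP => //; exact: By.
- by case: ifP => //; exact: Cy.
split=> j jn.
- by have := BCy j; rewrite leq_max jn => -[].
- by have := BCy j; rewrite leq_max jn orbT => -[].
Qed.

Lemma rectangles_generate : @measurable _ (RN R) = <<s rectangles >>.
Proof.
apply/seteqP; split.
  apply: smallest_sub; first exact: smallest_sigma_algebra.
  move=> _ [j _ [B mB <-]]; apply: sub_sigma_algebra.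
  exists j.+1, (fun i => if i == j then B else setT); split.
    by move=> i; case: ifP.
  rewrite setTI; apply/seteqP; split=> [y /= By i _|y /(_ j)].
    by case: eqP => // ->.
  by rewrite eqxx; exact.
apply: smallest_sub; first exact: smallest_sigma_algebra.
move=> _ [n [B [mB ->]]].
rewrite (_ : [set _ | _] =
    \bigcap_(j in [set j | (j < n)%N]) ((fun y : RN R => (y : nat -> R) j) @^-1` B j))//.
apply: bigcap_measurableType => j _.
by have := measurable_coordinate j measurableT (mB j); rewrite setTI.
Qed.

Definition coordinate (j : nat) (y : RN R) : R := (y : nat -> R) j.

HB.instance Definition _ (j : nat) :=
  isMeasurableFun.Build _ _ _ _ (coordinate j) (measurable_coordinate j).

End ProductMeasurable.

Section ProductMeasure.
Context {R : realType} (beta : R) (mu : probability (RN R) R).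
Hypothesis hmu : is_product_beta_gauss beta mu.

Lemma beta_gaussT : beta_gauss beta setT = 1%E.
Proof.
have := hmu 1%N (fun _ => measurableT); rewrite big_ord1 => <-.
by rewrite (_ : [set _ | _] = setT) ?probability_setT//; exact/seteqP.
Qed.

Lemma coordinate_law j (B : set R) : measurable B ->
  mu [set y | B ((y : nat -> R) j)] = beta_gauss beta B.
Proof.
move=> mB.
have := hmu j.+1 (B := fun i => if i == j then B else setT).
rewrite (_ : [set _ | _] = [set y | B ((y : nat -> R) j)]); last first.
  apply/seteqP; split=> [y /(_ j)|y By i _]; first by rewrite eqxx; exact.
  by case: eqP => // ->.
move=> -> => [|i]; last by case: ifP.
rewrite big_ord_recr/= eqxx big1 ?mul1e// => i _.
by rewrite ltn_eqF// beta_gaussT.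
Qed.

Lemma expectation_indic j (B : set R) : measurable B ->
  (\int[mu]_y (\1_B ((y : nat -> R) j))%:E = mu [set y | B ((y : nat -> R) j)])%E.
Proof.
move=> mB.
transitivity (\int[mu]_y (\1_[set y : RN R | B ((y : nat -> R) j)] y)%:E)%E => //.
rewrite integral_indic ?setIT//.
by have := measurable_coordinate j measurableT mB; rewrite setTI.
Qed.

(** Independence of the coordinates, extended from sets to functions one
    coordinate at a time: in the statement [Q m], the functions of index at
    least [m] are still indicators. *)
Lemma expectation_prod n (h : nat -> R -> R) (e : nat -> R) :
  (forall i, measurable_fun setT (h i)) -> (forall i x, 0 <= h i x) ->
  (forall i, (\int[mu]_y (h i ((y : nat -> R) i))%:E = (e i)%:E)%E) ->
  (\int[mu]_y (\prod_(i < n) h i ((y : nat -> R) i))%:E =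
   (\prod_(i < n) e i)%:E)%E.
Proof.
move=> mh h0 he.
suff Q m : forall (h : nat -> R -> R) (e : nat -> R),
    (forall i, measurable_fun setT (h i)) -> (forall i x, 0 <= h i x) ->
    (forall i, (\int[mu]_y (h i ((y : nat -> R) i))%:E = (e i)%:E)%E) ->
    (forall i, (m <= i < n)%N -> exists2 B, measurable B & h i = \1_B) ->
    (\int[mu]_y (\prod_(i < n) h i ((y : nat -> R) i))%:E =
     (\prod_(i < n) e i)%:E)%E.
  by apply: (Q n) => // i /andP[/leq_ltn_trans/[apply]]; rewrite ltnn.
elim: m => [|m ih] {mh h0 he}h {}e mh h0 he hind.
  have /choice[B hB] : forall i, exists B,
      measurable B /\ ((i < n)%N -> h i = \1_B).
    move=> i; have [lin|nin] := boolP (i < n)%N; last by exists set0.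
    by have [B mB hE] := hind i lin; exists B.
  have mB i : measurable (B i) by case: (hB i).
  rewrite (eq_integral (fun y =>
    (\1_[set y : RN R | forall j, (j < n)%N -> B j ((y : nat -> R) j)] y)%:E)).
    rewrite integral_indic//; last first.
      by rewrite rectangles_generate; apply: sub_sigma_algebra; exists n, B.
    rewrite setIT; transitivity (\prod_(i < n) beta_gauss beta (B i))%E.
      exact: hmu.
    rewrite -prodEFin; apply: eq_bigr => i _.
    by rewrite -he (hB i).2// -(coordinate_law i (mB i)) expectation_indic.
  move=> y _; congr (_%:E); rewrite indicE.
  case: (boolP (y \in _)) => [/set_mem/= yB|/negP yB].
    by rewrite big1// => i _; rewrite (hB i).2// indicE mem_set//; exact: yB.
  have [j /not_implyP[jn Byj]] : exists j, ~ ((j < n)%N -> B j ((y : nat -> R) j)).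
    by apply/existsNP => yB'; apply: yB; rewrite inE.
  rewrite (bigD1 (Ordinal jn))//= (hB j).2// indicE memNset// mul0r//.
have [nm|mn] := leqP n m.
  apply: ih => // i /andP[mi lin].
  by have := leq_trans lin (leq_trans nm mi); rewrite ltnn.
have prodE (f : nat -> R) : \prod_(i < n) f i =
    (\prod_(i < n | i != Ordinal mn) f i) * f m.
  by rewrite (bigD1 (Ordinal mn))//= mulrC.
pose H (y : RN R) := \prod_(i < n | i != Ordinal mn) h i ((y : nat -> R) i).
pose c := \prod_(i < n | i != Ordinal mn) e i.
have e0 i : 0 <= e i.
  by rewrite -lee_fin -he; apply: integral_ge0 => y _; rewrite lee_fin.
have mhi i : measurable_fun [set: RN R] (fun y => h i ((y : nat -> R) i)).
  exact: measurableT_comp (mh i) (measurable_coordinate i).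
under eq_integral => y _ do rewrite (prodE (fun i => h i ((y : nat -> R) i))).
rewrite prodE (EFinM c) -he.
transitivity (c%:E * \int[distribution mu (coordinate m)]_z (h m z)%:E)%E; last first.
  rewrite ge0_integral_distribution//; last by move=> y; rewrite lee_fin.
  by apply/measurable_EFinP; exact: mh.
apply: (@integral_mul_comp _ _ _ _ _ mu (distribution mu (coordinate m)) (coordinate m) H c) => //.
- have -> : H = fun y : RN R => \prod_(i < n)
      (if i != Ordinal mn then h i ((y : nat -> R) i) else 1).
    by apply/funext => y; rewrite /H big_mkcond.
  by apply: measurable_prod => i _ /=; case: (i != Ordinal mn).
- by move=> x; rewrite /H; apply: prodr_ge0.
move=> B mB.
pose h' i := if i == m then \1_B : R -> R else h i.
pose e' i := if i == m then fine (distribution mu (coordinate m) B) else e i.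
have Bfin : distribution mu (coordinate m) B \is a fin_num by exact: fin_num_measure.
have h'E y : \prod_(i < n) h' i ((y : nat -> R) i) = H y * \1_B (coordinate m y).
  rewrite (prodE (fun i => h' i ((y : nat -> R) i))) {2}/h' eqxx; congr (_ * _); apply: eq_bigr => i im.
  by rewrite /h' ifN.
have e'E : \prod_(i < n) e' i = c * fine (distribution mu (coordinate m) B).
  rewrite prodE {2}/e' eqxx; congr (_ * _); apply: eq_bigr => i im.
  by rewrite /e' ifN.
under eq_integral do rewrite -h'E.
rewrite -[X in _ = (_ * X)%E](fineK Bfin) -EFinM -e'E; apply: ih => [i|i x|i|i].
- by rewrite /h'; case: ifP => // _; exact: measurable_indic.
- by rewrite /h'; case: ifP.
- rewrite /h' /e'; case: eqP => [->|//].
  by rewrite fineK// expectation_indic.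
- rewrite /h'; case: eqP => [_ _|im /andP[mi lin]]; first by exists B.
  by apply: hind; rewrite lin andbT ltn_neqAle mi andbT; apply/eqP => /esym.
Qed.

End ProductMeasure.

Section BetaGauss.
Context {R : realType}.
Implicit Types (beta t : R).

Lemma beta_gauss_cst_ge0 beta :
  0 <= (2 * beta `^ beta^-1 * Gamma (1 + beta^-1))^-1.
Proof.
rewrite invr_ge0 !mulr_ge0 ?powR_ge0//.
by apply: Rintegral_ge0 => t _; rewrite mulr_ge0 ?powR_ge0 ?expR_ge0.
Qed.

Lemma beta_gauss_pdf_ge0 beta t : 0 <= beta_gauss_pdf beta t.
Proof. by rewrite mulr_ge0 ?expR_ge0 ?beta_gauss_cst_ge0. Qed.

Lemma beta_gauss_pdfN beta t : beta_gauss_pdf beta (- t) = beta_gauss_pdf beta t.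
Proof. by rewrite /beta_gauss_pdf normrN. Qed.

Lemma measurable_beta_gauss_pdf beta : measurable_fun setT (beta_gauss_pdf beta).
Proof.
apply: measurable_funM => //; apply: measurableT_comp => //.
apply: measurableT_comp => //; apply: measurable_funM => //.
apply: (measurableT_comp (measurable_powR _)) => //.
Qed.

Lemma beta_gaussN beta (B : set R) : measurable B ->
  beta_gauss beta (-%R @^-1` B) = beta_gauss beta B.
Proof.
move=> mB; rewrite /beta_gauss.
transitivity (\int[@lebesgue_measure R]_(y in -%R @^-1` B)
    ((EFin \o beta_gauss_pdf beta) \o -%R) y)%E.
  by apply: eq_integral => y _ /=; rewrite beta_gauss_pdfN.
rewrite -(@ge0_integral_pushforward _ _ (measurableTypeR R) (measurableTypeR R) _ -%R)//=.
- by apply: eq_measure_integral => A mA _; exact: lebesgue_measureN.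
- by apply/measurable_EFinP/measurable_funTS; exact: measurable_beta_gauss_pdf.
- by move=> y _; rewrite lee_fin beta_gauss_pdf_ge0.
Qed.

End BetaGauss.

Section Flip.
Context {R : realType} (beta : R) (mu : probability (RN R) R).
Hypothesis hmu : is_product_beta_gauss beta mu.

Definition flip (j : nat) (y : RN R) : RN R :=
  [eta (y : nat -> R) with j |-> - (y : nat -> R) j].

Lemma measurable_flip j : measurable_fun setT (flip j).
Proof.
apply: measurable_to_RN => i; rewrite /flip /=.
case: (eqVneq i j) => _; last exact: measurable_coordinate.
by apply: measurableT_comp => //; exact: measurable_coordinate.
Qed.

HB.instance Definition _ (j : nat) :=
  isMeasurableFun.Build _ _ _ _ (flip j) (measurable_flip j).

(** The one-dimensional law is symmetric, so reflecting one coordinate preserves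
    the measure of every rectangle. *)
Lemma flip_invariant j (A : set (RN R)) : measurable A ->
  distribution mu (flip j) A = mu A.
Proof.
apply: (@measure_unique _ R (RN R) (@rectangles R) (fun=> setT)
  rectangles_generate (@setI_closed_rectangles R)) => //.
- by move=> _; exists 0%N, (fun=> setT); split => //; exact/seteqP.
- by rewrite bigcup_const.
- move=> _ [n [B [mB ->]]].
  pose B' i := if i == j then -%R @^-1` B i else B i.
  have mB' i : measurable (B' i).
    rewrite /B'; case: ifP => // _.
    have mN : measurable_fun setT (-%R : R -> R) by [].
    by have := mN measurableT _ (mB i); rewrite setTI.
  transitivity (mu [set y : RN R | forall i, (i < n)%N -> B' i ((y : nat -> R) i)]).
    rewrite /distribution /pushforward; congr (mu _).
    apply/seteqP; split => y /= By i /By.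
      by rewrite /B' /flip /=; case: (eqVneq i j) => [->|_].
    by rewrite /B' /flip /=; case: (eqVneq i j) => [->|_].
  transitivity (\prod_(i < n) beta_gauss beta (B' i))%E; first exact: hmu.
  transitivity (\prod_(i < n) beta_gauss beta (B i))%E; last exact/esym/hmu.
  by apply: eq_bigr => i _; rewrite /B'; case: ifP => // _; exact: beta_gaussN.
- by move=> _; rewrite ltey_eq fin_num_measure.
Qed.

Lemma integral_flip j (U : set (RN R)) (F : RN R -> R) :
  measurable U -> flip j @^-1` U = U -> measurable_fun setT F ->
  mu.-integrable U (EFin \o F) ->
  (\int[mu]_(y in U) (F (flip j y))%:E = \int[mu]_(y in U) (F y)%:E)%E.
Proof.
move=> mU flipU mF iF.
have eqint (f : RN R -> \bar R) :
    (\int[mu]_(y in U) f y = \int[distribution mu (flip j)]_(y in U) f y)%E.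
  by apply: eq_measure_integral => A mA _; exact/esym/flip_invariant.
have mEF : measurable_fun setT (EFin \o F) by exact/measurable_EFinP.
have mFf : measurable_fun setT (F \o flip j) by exact: measurableT_comp.
have iFf : mu.-integrable (flip j @^-1` U) ((EFin \o F) \o flip j).
  rewrite flipU; apply/integrableP; split.
    by apply: measurable_funTS; exact/measurable_EFinP.
  case/integrableP: iF => _; rewrite eqint ge0_integral_pushforward ?flipU//.
  by apply: measurableT_comp => //; exact: measurable_funTS.
by rewrite [RHS]eqint (integral_pushforward (measurable_flip j) mEF iFf)// flipU.
Qed.

End Flip.

(** * Moments of the exponential weights *)

Section ScalarEstimates.
Context {R : realType}.
Implicit Types (x t : R).

Lemma linear_quadratic_le_expR (e x : R) : 0 < e -> 0 <= x ->
  x + x ^+ 2 <= (e^-1 + 4 * e^-1 ^+ 2) * expR (e * x).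
Proof.
move=> e0 x0.
have h1 : e * x <= expR (e * x) by apply: le_trans (expR_ge1Dx _); rewrite lerDr.
have h2 : (e * x / 2) ^+ 2 <= expR (e * x).
  have -> : expR (e * x) = expR (e * x / 2) ^+ 2.
    by rewrite -expRM_natl; congr expR; field.
  rewrite lerXn2r ?nnegrE ?expR_ge0//.
    by rewrite divr_ge0// mulr_ge0// ltW.
  by apply: le_trans (expR_ge1Dx _); rewrite lerDr.
have en0 : e != 0 by rewrite gt_eqF.
rewrite mulrDl lerD//.
  by rewrite -ler_pdivrMl ?invr_gt0// invrK.
have -> : x ^+ 2 = 4 * e^-1 ^+ 2 * (e * x / 2) ^+ 2 by field.
by rewrite ler_wpM2l// mulr_ge0// exprn_ge0// invr_ge0 ltW.
Qed.

Lemma expR_le1_linear (a x : R) : expR (a * x) <= 1 + a * (x * expR (a * x)).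
Proof.
have := expR_ge1Dx (- (a * x)).
rewrite -(ler_pM2r (expR_gt0 (a * x))) -expRD addNr expR0 mulrDl mul1r.
by move=> h; rewrite -lerBlDr; lra.
Qed.

Lemma prod_1D_le_expR (a : nat -> R) n : (forall i, 0 <= a i) ->
  \prod_(i < n) (1 + a i) <= expR (\sum_(i < n) a i).
Proof.
move=> a0; elim: n => [|n ih]; first by rewrite !big_ord0 expR0.
rewrite !big_ord_recr/= expRD ler_pM ?expR_ge1Dx//.
  by apply: prodr_ge0 => i _; rewrite addr_ge0.
by rewrite addr_ge0.
Qed.

Lemma in_ell1_partial_sum (alpha : nat -> R) : (forall j, 0 <= alpha j) ->
  in_ell 1 alpha -> exists S, forall n, \sum_(i < n) alpha i <= S.
Proof.
move=> a0 ha.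
exists (fine (\sum_(0 <= j <oo) (`|alpha j| `^ 1)%:E)%E) => n.
have le : (\sum_(0 <= j < n) (`|alpha j| `^ 1)%:E <=
    \sum_(0 <= j <oo) (`|alpha j| `^ 1)%:E)%E.
  by apply: nneseries_lim_ge => j _ _; rewrite lee_fin powR_ge0.
rewrite -lee_fin fineK; last first.
  rewrite ge0_fin_numE//; apply: nneseries_ge0 => j _ _; by rewrite lee_fin powR_ge0.
apply: le_trans le; rewrite big_mkord -sumEFin; apply: lee_sum => i _.
by rewrite lee_fin powRr1// ger0_norm.
Qed.

Lemma partial_sum_bounded_cvg0 (alpha : nat -> R) S : (forall j, 0 <= alpha j) ->
  (forall n, \sum_(i < n) alpha i <= S) -> alpha @ \oo --> (0 : R).
Proof.
move=> a0 hS; apply: cvg_series_cvg_0.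
apply: nondecreasing_is_cvgn.
  by apply/nondecreasing_seqP => n; rewrite !seriesEnat/= big_nat_recr//= lerDl.
by exists S => _ [n _ <-]; rewrite seriesEord; exact: hS.
Qed.

(** The room that makes exponential moments finite: some rate [A'] strictly above
    all the [alpha j] is still beaten by the exponent of the density.  For
    [beta = 1] the supremum of [alpha] is less than [1] because [alpha] tends to
    [0]; for [beta > 1] any rate will do, as [t `^ beta] outgrows linear
    functions. *)
Lemma exponent_gap (beta : R) (alpha : nat -> R) : 1 <= beta ->
  (forall j, 0 <= alpha j) -> in_ell 1 alpha ->
  (beta = 1 -> forall j, alpha j < 1) ->
  exists A A' delta K, [/\ forall j, alpha j <= A, A < A', 0 < delta &
    forall t, 0 <= t -> A' * t - t `^ beta / beta <= K - delta * t].
Proof.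
move=> b1 a0 /in_ell1_partial_sum-/(_ a0)[S hS] hb.
have aS j : alpha j <= S.
  by apply: le_trans (hS j.+1); rewrite big_ord_recr/= lerDr sumr_ge0.
move: b1; rewrite le_eqVlt => /predU1P[beta1|b1].
  have /cvgrPdist_lt/(_ (2^-1)) := partial_sum_bounded_cvg0 a0 hS.
  rewrite invr_gt0 ltr0n => /(_ isT)[N _ hN].
  pose A := \big[Num.max/2^-1]_(i < N) alpha i.
  have A1 : A < 1.
    rewrite /A; elim/big_ind: _ => [|x y x1 y1|i _].
    - by rewrite invf_lt1// ltr1n.
    - by rewrite gt_max x1 y1.
    - exact: hb.
  exists A, ((1 + A) / 2), (1 - (1 + A) / 2), 0; split.
  - move=> j; have [jN|Nj] := ltnP j N.
      exact: (le_bigmax _ (fun i : 'I_N => alpha i) (Ordinal jN)).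
    apply: le_trans (bigmax_ge_id _ _ _ _); apply/ltW.
    by have := hN j Nj; rewrite /= sub0r normrN ger0_norm.
  - by lra.
  - by lra.
  - by move=> t t0; rewrite -beta1 powRr1// divr1; lra.
have be0 : 0 < beta - 1 by rewrite subr_gt0.
have S0 : 0 <= S by apply: le_trans (aS 0%N).
(* beyond [T0], where [T0 `^ (beta - 1) = L], the quotient [t `^ beta / beta] is
   at least [(S + 2) * t] *)
pose L := beta * (S + 2).
have L0 : 0 <= L by apply: mulr_ge0; lra.
pose T0 := L `^ (beta - 1)^-1.
have T00 : 0 <= T0 by exact: powR_ge0.
have bgt0 : 0 < beta by rewrite (lt_trans _ b1).
exists S, (S + 1), 1, ((S + 2) * T0); split => //; first by rewrite ltrDl.
move=> t t0.
suff : (S + 2) * t - t `^ beta / beta <= (S + 2) * T0 by lra.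
have [tT|Tt] := leP t T0.
  apply: le_trans (_ : (S + 2) * t <= _).
    by rewrite gerBl divr_ge0 ?powR_ge0 ?ltW.
  by apply: ler_wpM2l => //; lra.
apply: (@le_trans _ _ 0); last by apply: mulr_ge0 => //; lra.
rewrite subr_le0 ler_pdivlMr//.
have tgt0 : 0 < t by exact: le_lt_trans Tt.
have -> : t `^ beta = t * t `^ (beta - 1).
  by rewrite -{2}(powRr1 (ltW tgt0)) -powRD ?(gt_eqF tgt0) ?implybT// addrC subrK.
have : L <= t `^ (beta - 1).
  have -> : L = T0 `^ (beta - 1) by rewrite /T0 -powRrM mulVf ?gt_eqF// powRr1.
  by apply: ge0_ler_powR; [exact: ltW|rewrite nnegrE|rewrite nnegrE|exact: ltW].
by move=> /(ler_wpM2l t0); apply: le_trans; rewrite /L; lra.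
Qed.

End ScalarEstimates.

Section LebesgueReflection.
Context {R : realType}.
Local Open Scope ereal_scope.
Notation leb := (@lebesgue_measure R).

Lemma ge0_integral_lebesgueN (f : R -> \bar R) : measurable_fun setT f ->
  (forall x, 0 <= f x) -> \int[leb]_x f (- x)%R = \int[leb]_x f x.
Proof.
move=> mf f0.
rewrite -[LHS](@ge0_integral_pushforward _ _ (measurableTypeR R)
  (measurableTypeR R) _ -%R _ leb setT f)//=.
by apply: eq_measure_integral => A mA _; exact: lebesgue_measureN.
Qed.

Lemma integral_expR_abs_lty (delta : R) : (0 < delta)%R ->
  \int[leb]_x (expR (- (delta * `|x|)))%:E < +oo.
Proof.
move=> d0; have d0' := ltW d0.
pose f (x : R) := (delta^-1)%:E * (exponential_pdf delta x)%:E.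
have mf : measurable_fun setT f.
  apply/measurable_EFinP; apply: measurable_funM => //.
  exact: measurable_exponential_pdf.
have f0 x : 0 <= f x.
  by rewrite mule_ge0 ?lee_fin ?invr_ge0// exponential_pdf_ge0.
have intf : \int[leb]_x f x = (delta^-1)%:E.
  rewrite ge0_integralZl//.
  - by rewrite integral_exponential_pdf// mule1.
  - by apply/measurable_EFinP; exact: measurable_exponential_pdf.
  - by move=> x _; rewrite lee_fin exponential_pdf_ge0.
  - by rewrite lee_fin invr_ge0.
apply: (@le_lt_trans _ _ (\int[leb]_x (f x + f (- x)%R))).
  apply: ge0_le_lower_integral => [x _|x _]; first by rewrite lee_fin expR_ge0.
  have fE y : (0 <= y)%R -> f y = (expR (- (delta * y)))%:E.
    move=> y0; rewrite /f exponential_pdfE// -EFinM mulrA mulVf ?gt_eqF// mul1r.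
    by rewrite mulNr.
  have [x0|x0] := leP 0%R x.
    by rewrite ger0_norm// fE// leeDl.
  by rewrite ltr0_norm// [f (- x)%R]fE ?leeDr// oppr_ge0 ltW.
rewrite ge0_integralD//; last first.
  by apply: (measurableT_comp mf).
by rewrite ge0_integral_lebesgueN// intf -EFinD ltry.
Qed.

End LebesgueReflection.

Section Moments.
Context {R : realType} (beta : R) (mu : probability (RN R) R).
Hypothesis hmu : is_product_beta_gauss beta mu.
Local Open Scope ereal_scope.

Lemma expectation_coordinate j (h : R -> R) : measurable_fun setT h ->
  (forall x, (0 <= h x)%R) ->
  \int[mu]_y (h ((y : nat -> R) j))%:E =
  \int[@lebesgue_measure R]_x (beta_gauss_pdf beta x * h x)%:E.
Proof.
move=> mh h0.
transitivity (1%:E * \int[distribution mu (coordinate j)]_z (h z)%:E).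
  rewrite mul1e ge0_integral_distribution//.
  exact/measurable_EFinP.
apply/esym/(@integral_mul_comp _ _ _ _ _ (@lebesgue_measure R)
  (distribution mu (coordinate j)) id (beta_gauss_pdf beta)) => //.
- exact: measurable_beta_gauss_pdf.
- exact: beta_gauss_pdf_ge0.
move=> B mB; rewrite mul1e; apply/esym; rewrite -[LHS]/(mu _).
rewrite (coordinate_law hmu)// /beta_gauss [LHS]integral_mkcond.
apply: eq_integral => x _; rewrite patchE indicE.
by case: ifPn; rewrite ?mulr1 ?mulr0.
Qed.

Variable alpha : nat -> R.
Hypotheses (hbeta : (1 <= beta)%R) (alpha0 : forall j, (0 <= alpha j)%R).
Hypotheses (alpha1 : in_ell 1 alpha).
Hypothesis (hbeta1 : beta = 1%R -> forall j, (alpha j < 1)%R).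

(** Both [x ^+ 2] and the excess [expR (alpha j * x) - 1], which is at most
    [alpha j * x * expR (alpha j * x)], are absorbed by the gap between
    [alpha j] and the rate [A']; hence a single constant [m] serves for every
    coordinate, and the excess keeps its factor [alpha j], which is what makes
    infinite products converge. *)
Lemma one_coordinate_moments : exists2 m : R, (0 <= m)%R & forall j,
  \int[mu]_y (expR (alpha j * `|(y : nat -> R) j|))%:E <= (1 + alpha j * m)%:E /\
  \int[mu]_y (((y : nat -> R) j) ^+ 2 * expR (alpha j * `|(y : nat -> R) j|))%:E
    <= m%:E.
Proof.
have [A [A' [delta [K [aA AA' d0 gap]]]]] := exponent_gap hbeta alpha0 alpha1 hbeta1.
(* [q] comes from absorbing [x + x ^+ 2] in [expR ((A' - A) * x)], and [I] is the
   moment at the rate [A'], the same for every coordinate *)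
pose cst := ((2 * beta `^ beta^-1 * Gamma (1 + beta^-1))^-1)%R.
have cst0 : (0 <= cst)%R by exact: beta_gauss_cst_ge0.
pose q : R := (((A' - A)^-1 + 4 * (A' - A)^-1 ^+ 2))%R.
have eps0 : (0 < A' - A)%R by rewrite subr_gt0.
have q0 : (0 <= q)%R.
  by rewrite addr_ge0 ?mulr_ge0 ?exprn_ge0 ?invr_ge0// ltW.
have mexp a : measurable_fun setT (fun x : R => expR (a * `|x|)).
  by apply: measurableT_comp => //; apply: measurable_funM.
pose I := \int[@lebesgue_measure R]_x (beta_gauss_pdf beta x * expR (A' * `|x|))%:E.
have I0 : 0 <= I.
  by apply: integral_ge0 => x _; rewrite lee_fin mulr_ge0 ?beta_gauss_pdf_ge0 ?expR_ge0.
have Ifin : I \is a fin_num.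
  rewrite ge0_fin_numE//.
  apply: (@le_lt_trans _ _ (\int[@lebesgue_measure R]_x
      ((cst * expR K)%:E * (expR (- (delta * `|x|)))%:E))).
    apply: ge0_le_lower_integral => x _.
      by rewrite lee_fin mulr_ge0 ?beta_gauss_pdf_ge0 ?expR_ge0.
    rewrite -EFinM lee_fin /beta_gauss_pdf -/cst -!mulrA ler_wpM2l//.
    rewrite -!expRD ler_expR.
    by have := gap `|x|%R (normr_ge0 x); lra.
  have Kc0 : 0 <= (cst * expR K)%:E by rewrite lee_fin mulr_ge0// expR_ge0.
  rewrite ge0_integralZl//.
  - by apply: lte_mul_pinfty => //; exact: integral_expR_abs_lty.
  - apply/measurable_EFinP; apply: measurableT_comp => //.
    by apply: measurableT_comp => //; exact: measurable_funM.
have EI j : \int[mu]_y (expR (A' * `|(y : nat -> R) j|))%:E = I.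
  by rewrite (@expectation_coordinate j (fun x => expR (A' * `|x|))%R) // => x; exact: expR_ge0.
have mcoord (h : R -> R) j : measurable_fun setT h ->
    measurable_fun [set: RN R] (fun y => (h ((y : nat -> R) j))%:E).
  move=> mh; apply/measurable_EFinP.
  exact: measurableT_comp mh (measurable_coordinate j).
have qI j : \int[mu]_y (q%:E * (expR (A' * `|(y : nat -> R) j|))%:E) = q%:E * I.
  rewrite ge0_integralZl//; first by rewrite EI.
  - exact: (mcoord (fun x => expR (A' * `|x|))%R).
have key j (x : R) : ((`|x| + x ^+ 2) * expR (alpha j * `|x|) <= q * expR (A' * `|x|))%R.
  have := linear_quadratic_le_expR eps0 (normr_ge0 x).
  rewrite -/q real_normK ?num_real// => h.
  have -> : (A' * `|x| = (A' - A) * `|x| + A * `|x|)%R by rewrite -mulrDl subrK.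
  rewrite expRD mulrA ler_pM//.
  - by rewrite addr_ge0// sqr_ge0.
  - by rewrite ler_expR ler_wpM2r.
have ex0 j (x : R) : (0 <= expR (alpha j * `|x|))%R by exact: expR_ge0.
exists (q * fine I)%R; first by rewrite mulr_ge0// fine_ge0.
move=> j; split.
  apply: (@le_trans _ _ (\int[mu]_y (1 + (alpha j)%:E *
      (q%:E * (expR (A' * `|(y : nat -> R) j|))%:E)))).
    apply: ge0_le_lower_integral => y _; first by rewrite lee_fin.
    rewrite -!EFinM -EFinD lee_fin; apply: le_trans (expR_le1_linear _ _) _.
    rewrite lerD2l ler_wpM2l//; apply: le_trans (key j _).
    by rewrite ler_wpM2r// lerDl sqr_ge0.
  have mq : measurable_fun [set: RN R]
      (fun y => q%:E * (expR (A' * `|(y : nat -> R) j|))%:E).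
    apply: emeasurable_funM => //; exact: (mcoord (fun x => expR (A' * `|x|))%R).
  rewrite ge0_integralD//; last 2 first.
  - by move=> y _; rewrite !mule_ge0 ?lee_fin ?expR_ge0.
  - exact: emeasurable_funM.
  rewrite ge0_integralZl ?lee_fin//.
  have muT : mu [set: RN R] = 1 := probability_setT mu.
  rewrite qI integral_cst// [X in 1 * X]muT mule1.
  by rewrite -(fineK Ifin) -!EFinM -EFinD.
  by move=> y _; rewrite mule_ge0 ?lee_fin ?expR_ge0.
rewrite EFinM fineK// -(qI j); apply: ge0_le_lower_integral => y _.
  by rewrite lee_fin mulr_ge0// sqr_ge0.
rewrite -EFinM lee_fin; apply: le_trans (key j _).
by rewrite ler_wpM2r// lerDr.
Qed.

End Moments.

Definition partial_weight {R : realType} (alpha : nat -> R) (n : nat)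
    (y : nat -> R) : R :=
  \prod_(i < n) expR (alpha i * `|y i|).

Section WeightMoments.
Context {R : realType} (beta : R) (mu : probability (RN R) R).
Hypothesis hmu : is_product_beta_gauss beta mu.
Variable alpha : nat -> R.
Hypotheses (hbeta : 1 <= beta) (alpha0 : forall j, 0 <= alpha j).
Hypotheses (alpha1 : in_ell 1 alpha).
Hypothesis (hbeta1 : beta = 1 -> forall j, alpha j < 1).

(** By independence the mean of the weight is a product of factors at most
    [1 + alpha i * m], so it is bounded by the exponential of [m] times the sum
    of [alpha]. *)
Lemma partial_weight_moments : exists M : R,
  [/\ 0 <= M,
    forall n, (\int[mu]_y (partial_weight alpha n y)%:E <= M%:E)%E &
    forall j, (\int[mu]_y (((y : nat -> R) j) ^+ 2 * partial_weight alpha j.+1 y)%:E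
               <= M%:E)%E].
Proof.
have [S hS] := in_ell1_partial_sum alpha0 alpha1.
have [m m0 hm] := one_coordinate_moments hmu hbeta alpha0 alpha1 hbeta1.
pose h i (x : R) := expR (alpha i * `|x|).
pose h2 i (x : R) := x ^+ 2 * expR (alpha i * `|x|).
have mh i : measurable_fun setT (h i).
  by apply: measurableT_comp => //; apply: measurable_funM.
have mh2 i : measurable_fun setT (h2 i).
  by apply: measurable_funM; [exact: measurable_funX|exact: mh].
have h0 i x : 0 <= h i x by exact: expR_ge0.
have h20 i x : 0 <= h2 i x by rewrite mulr_ge0 ?expR_ge0 ?sqr_ge0.
pose e i := fine (\int[mu]_y (h i ((y : nat -> R) i))%:E)%E.
pose e2 i := fine (\int[mu]_y (h2 i ((y : nat -> R) i))%:E)%E.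
have he i : (\int[mu]_y (h i ((y : nat -> R) i))%:E)%E = (e i)%:E.
  rewrite fineK// ge0_fin_numE ?(le_lt_trans (hm i).1) ?ltry//.
  by apply: integral_ge0 => y _; rewrite lee_fin.
have he2 i : (\int[mu]_y (h2 i ((y : nat -> R) i))%:E)%E = (e2 i)%:E.
  rewrite fineK// ge0_fin_numE ?(le_lt_trans (hm i).2) ?ltry//.
  by apply: integral_ge0 => y _; rewrite lee_fin.
have e0 i : 0 <= e i.
  by rewrite -lee_fin -he; apply: integral_ge0 => y _; rewrite lee_fin.
have e20 i : 0 <= e2 i.
  by rewrite -lee_fin -he2; apply: integral_ge0 => y _; rewrite lee_fin.
have prod_e_le n : \prod_(i < n) e i <= expR (S * m).
  apply: (@le_trans _ _ (\prod_(i < n) (1 + alpha i * m))).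
    apply: ler_prod => i _; rewrite e0/= -lee_fin -he; exact: (hm i).1.
  have am0 i : 0 <= alpha i * m by rewrite mulr_ge0.
  apply: le_trans (prod_1D_le_expR n am0) _.
  by rewrite ler_expR -mulr_suml ler_wpM2r.
exists (expR (S * m) * (1 + m)); split.
- by rewrite mulr_ge0 ?expR_ge0// addr_ge0.
- move=> n; rewrite (expectation_prod hmu n mh h0 he) lee_fin.
  by apply: le_trans (prod_e_le n) _; rewrite ler_peMr ?expR_ge0// lerDl.
move=> j; pose k i := if i == j then h2 i else h i.
pose ek i := if i == j then e2 i else e i.
have kE (y : nat -> R) :
    y j ^+ 2 * partial_weight alpha j.+1 y = \prod_(i < j.+1) k i (y i).
  rewrite /partial_weight !big_ord_recr/= {2}/k eqxx /h2 mulrCA; congr (_ * _).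
  by apply: eq_bigr => i _; rewrite /k ltn_eqF.
under eq_integral do rewrite kE.
have mk i : measurable_fun setT (k i) by rewrite /k; case: ifP.
have k0 i x : 0 <= k i x by rewrite /k; case: ifP.
have hk i : (\int[mu]_y (k i ((y : nat -> R) i))%:E)%E = (ek i)%:E.
  by rewrite /k /ek; case: ifP.
rewrite (expectation_prod hmu j.+1 mk k0 hk) lee_fin big_ord_recr/= {2}/ek eqxx.
apply: ler_pM => //; first by apply: prodr_ge0 => i _; rewrite /ek; case: ifP.
  apply: le_trans (prod_e_le j); rewrite le_eqVlt; apply/orP; left; apply/eqP.
  by apply: eq_bigr => i _; rewrite /ek ltn_eqF.
by rewrite -lee_fin -he2 EFinD (le_trans (hm j).2)// lee_fin lerDr.
Qed.

End WeightMoments.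

(** * Tails of the sequence b *)

(** Monotonicity gives [s * b s `^ p <= S], where [S] is the sum of the
    [b j `^ p]; then [b j ^+ 2 = b j `^ p * b j `^ (2 - p)], where the second
    factor is at most [(S / s) `^ ((2 - p) / p)] for [j >= s]. *)
Lemma tail_sum_sq_le (R : realType) (p : R) (b : nat -> R) : 0 < p < 1 ->
  (forall j, 0 <= b j) -> nonincreasing_seq b -> in_ell p b ->
  exists2 C, 0 <= C & forall s n, (0 < s)%N ->
    \sum_(s <= j < n) b j ^+ 2 <= C * s%:R `^ (- (2 / p) + 1).
Proof.
move=> /andP[p0 p1] b0 b_mono hb.
have pn0 : p != 0 by rewrite gt_eqF.
pose S := fine (\sum_(0 <= j <oo) (`|b j| `^ p)%:E)%E.
have terms0 j : (0 <= (`|b j| `^ p)%:E)%E by rewrite lee_fin powR_ge0.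
have S0 : 0 <= S by rewrite fine_ge0// nneseries_ge0.
have hS n : \sum_(0 <= j < n) b j `^ p <= S.
  rewrite -lee_fin fineK; last first.
    by rewrite ge0_fin_numE//; apply: nneseries_ge0.
  apply: le_trans (@nneseries_lim_ge _ _ xpredT 0%N n _) => //.
  rewrite -sumEFin; apply: lee_sum => i _; by rewrite lee_fin ger0_norm.
pose r := 2 / p - 1.
have r0 : 0 <= r.
  rewrite subr_ge0 ler_pdivlMr// mul1r; lra.
(* with [r] the exponent [(2 - p) / p] *)
exists (S * S `^ r) => [|s n s0]; first by rewrite mulr_ge0// powR_ge0.
have s0R : 0 < s%:R :> R by rewrite ltr0n.
have bs : b s `^ p <= S / s%:R.
  rewrite ler_pdivlMr//; apply: le_trans (hS s).
  rewrite mulr_natr -[X in _ *+ X]subn0 -sumr_const_nat big_nat [leRHS]big_nat.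
  apply: ler_sum => j /andP[_ js]; apply: ge0_ler_powR; rewrite ?nnegrE//.
    exact: ltW.
  by apply: b_mono; exact: ltnW.
have b2E x : 0 <= x -> x ^+ 2 = x `^ p * (x `^ p) `^ r.
  move=> x0; rewrite -powRrM -powRD.
    rewrite -powR_mulrn//; congr (_ `^ _); rewrite /r; by field.
  apply/implyP => /eqP; rewrite /r mulrBr mulr1 mulrCA mulfV// mulr1; lra.
have -> : s%:R `^ (- (2 / p) + 1) = (s%:R^-1) `^ r :> R.
  rewrite -[X in _ = X `^ _]powR_inv1 ?ler0n// -powRrM; congr (_ `^ _); rewrite /r; by field.
rewrite -mulrA -powRM ?invr_ge0 ?ler0n//.
apply: (@le_trans _ _ (\sum_(s <= j < n) b j `^ p * (S / s%:R) `^ r)).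
  rewrite big_nat [leRHS]big_nat; apply: ler_sum => j /andP[sj _].
  rewrite b2E// ler_wpM2l ?powR_ge0//.
  apply: ge0_ler_powR; rewrite ?nnegrE ?powR_ge0 ?divr_ge0 ?ler0n//.
  apply: le_trans bs; apply: ge0_ler_powR; rewrite ?nnegrE//.
    exact: ltW.
  exact: b_mono.
rewrite -mulr_suml ler_wpM2r ?powR_ge0//.
have [sn|ns] := leqP s n; last by rewrite big_geq// ltnW.
apply: le_trans (hS n); rewrite [leRHS](@big_cat_nat _ _ _ s)//= lerDr.
by apply: sumr_ge0 => j _; exact: powR_ge0.
Qed.

(** * Second differences *)

(** Two applications of the mean value theorem, first to [h u + h (- u)] on
    [[0, t]] and then to [h'] on [[- c, c]]. *)
Lemma second_difference_le (R : realType) (h h' h'' : R -> R) (B t : R) :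
  (forall u : R, is_derive u 1 h (h' u)) ->
  (forall u : R, is_derive u 1 h' (h'' u)) ->
  (forall u : R, `|u| <= `|t| -> `|h'' u| <= B) ->
  `|h t + h (- t) - 2 * h 0| <= 2 * B * t ^+ 2.
Proof.
move=> dh dh' h''B.
wlog t0 : t h''B / 0 <= t.
  move=> wl; have [t0|t0] := leP 0 t; first exact: wl.
  have := wl (- t); rewrite normrN opprK oppr_ge0 sqrrN (addrC (h (- t))).
  by apply => //; exact: ltW.
pose q u := h u + h (- u).
have dq (u : R) : is_derive u 1 q (h' u - h' (- u)).
  have dhN : is_derive u 1 (h \o -%R) (- h' (- u)).
    have := is_derive1_comp (dh (- u)) (is_deriveNid (u : R^o) 1).
    by rewrite mulrN1.
  exact: is_deriveD.
have cont (f f' : R -> R) a c : (forall u : R, is_derive u 1 f (f' u)) ->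
    {within `[a, c], continuous f}.
  move=> df; apply: derivable_within_continuous => u _.
  exact: (@ex_derive _ _ _ _ _ _ _ (df u)).
have [c c0t qE] := MVT_segment t0 (fun u _ => dq u) (cont _ _ 0 t dq).
move: c0t; rewrite in_itv/= => /andP[c0 ct].
have NCc : - c <= c by lra.
have [d dcc h'E] := MVT_segment NCc (fun u _ => dh' u) (cont _ _ (- c) c dh').
move: dcc; rewrite in_itv/= => /andP[cd dc].
have -> : h t + h (- t) - 2 * h 0 = q t - q 0 by rewrite /q oppr0; ring.
rewrite qE h'E subr0 !normrM.
have dt : `|d| <= `|t| by rewrite (ger0_norm t0) ler_norml; apply/andP; split; lra.
have hB := h''B d dt.
rewrite opprK (ger0_norm t0) (ger0_norm (addr_ge0 c0 c0)).
have B0 : 0 <= B by exact: le_trans hB.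
have -> : 2 * B * t ^+ 2 = B * (t + t) * t by ring.
by rewrite ler_wpM2r// ler_pM// ?addr_ge0// lerD.
Qed.

Lemma is_derive_linear_comp (R : realType) (X : normedModType R)
    (G : {linear X -> R^o}) (phi : R -> X) (u : R) :
  continuous G -> derivable phi u 1 ->
  is_derive u 1 (fun v => G (phi v) : R) (G (derive1 phi u)).
Proof.
move=> cG dphi.
have cv : h^-1 *: ((fun v => G (phi v) : R^o) (h *: 1 + u) - G (phi u)) @[h --> 0^'] -->
    (G (derive1 phi u) : R^o).
  under eq_fun do rewrite -linearB -linearZ.
  rewrite derive1E.
  exact: (cvg_comp _ _ dphi (cG _)).
apply: DeriveDef; first by apply/cvg_ex; eexists; exact: cv.
by apply: cvg_lim => //; exact: cv.
Qed.

(** * Measurability of functions of finitely many coordinates *)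

Lemma bigcup_countType_measurable d (T : measurableType d) (I : countType)
    (P : set I) (F : I -> set T) :
  (forall i, measurable (F i)) -> measurable (\bigcup_(i in P) F i).
Proof.
move=> mF.
rewrite (_ : \bigcup_(i in P) F i = \bigcup_k
    (if @choice.unpickle I k is Some i then F i `&` [set _ | P i] else set0)).
  apply: bigcupT_measurable => k; case: choice.unpickle => [i|//].
  have [Pi|Pi] := pselect (P i).
    by rewrite (_ : _ `&` _ = F i)//; apply/setIidl => y _; exact: Pi.
  by rewrite (_ : _ `&` _ = set0)// -subset0 => y [].
apply/seteqP; split => y.
  by move=> [i Pi Fi]; exists (choice.pickle i) => //; rewrite choice.pickleK.
by move=> [k _]; case: choice.unpickle => [i [Fi Pi]|//]; exists i.
Qed.

Section Rounding.
Context {R : realType}.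

Definition round_down (m : nat) (x : R) : R := (Num.floor (m.+1%:R * x))%:~R / m.+1%:R.

Lemma round_down_cvg (x : R) : round_down ^~ x @ \oo --> x.
Proof.
apply/cvgrPdist_le => e e0; near=> m.
have m0 : 0 < m.+1%:R :> R by [].
have -> : x - round_down m x =
    (m.+1%:R * x - (Num.floor (m.+1%:R * x))%:~R) / m.+1%:R.
  rewrite /round_down mulrBl; congr (_ - _).
  by rewrite mulrAC divff ?mul1r// gt_eqF.
have /andP[fl fu] := floor_itv (m.+1%:R * x).
rewrite ger0_norm ?divr_ge0 ?subr_ge0// ler_pdivrMr//.
apply: (@le_trans _ _ 1).
  by rewrite lerBlDl; move: fu; rewrite intrD addrC => /ltW; rewrite addrC.
rewrite -ler_pdivrMl// mulr1 (le_trans (ltW (truncnS_gt _)))// ler_nat ltnS.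
by near: m; exists (Num.truncn e^-1).
Unshelve. all: by end_near. Qed.

Definition round_head (n m : nat) (y : nat -> R) : nat -> R :=
  fun j => if (j < n)%N then round_down m (y j) else 0.

(** After rounding the first [n] coordinates to a grid, [Phi] factors through a
    countable set, so each rounded version is measurable whatever [Phi] is; a
    pointwise limit of measurable functions is measurable.  This only asks for
    convergence along the roundings, which allows combining truncations at
    different levels. *)
Lemma measurable_of_rounding (n : nat) (Phi : (nat -> R) -> R) :
  (forall y, Phi (round_head n m y) @[m --> \oo] --> Phi y) ->
  measurable_fun [set: RN R] (Phi : RN R -> R).
Proof.
move=> cvPhi.
apply: (@measurable_fun_cvg _ _ _ _ (fun m (y : RN R) => Phi (round_head n m y))); last first.
  by move=> y _; exact: cvPhi.
move=> m _ A mA; rewrite setTI.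
pose code (y : RN R) := [ffun i : 'I_n => Num.floor (m.+1%:R * (y : nat -> R) i)].
pose decode (q : {ffun 'I_n -> int}) : nat -> R :=
  fun j => if insub j is Some i then (q i)%:~R / m.+1%:R else 0.
have decodeK y : decode (code y) = round_head n m y.
  apply/funext => j; rewrite /decode /round_head.
  by case: insubP => [i -> ij|/negbTE -> //]; rewrite ffunE ij.
have mcode q : measurable (code @^-1` [set q]).
  rewrite (_ : _ @^-1` _ = \bigcap_(i in [set: 'I_n])
      (coordinate i @^-1` ((fun x => Num.floor (m.+1%:R * x)) @^-1` [set q i]))).
    apply: fin_bigcap_measurable => // i _.
    rewrite -[X in measurable X]setTI; apply: measurable_coordinate => //.
    rewrite (_ : _ @^-1` _ = `[(q i)%:~R / m.+1%:R, (q i + 1)%:~R / m.+1%:R[%classic).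
      exact: measurable_itv.
    have m0 : 0 < m.+1%:R :> R by [].
    apply/seteqP; split => x /=.
      move=> <-; rewrite in_itv/= ler_pdivrMr// ltr_pdivlMr// mulrC.
      exact: floor_itv.
    rewrite in_itv/= ler_pdivrMr// ltr_pdivlMr// mulrC => ?.
    exact: floor_def.
  apply/seteqP; split => y /=.
    by move=> <- i _ /=; rewrite ffunE.
  by move=> yq; apply/ffunP => i; rewrite ffunE; exact: yq.
rewrite (_ : _ @^-1` _ = \bigcup_(q in [set q | A (Phi (decode q))]) (code @^-1` [set q])).
  exact: bigcup_countType_measurable.
apply/seteqP; split => y /=.
  by rewrite -decodeK => Ay; exists (code y).
by move=> [q Aq yq]; rewrite -decodeK yq.
Qed.


Lemma truncate_set_head (n : nat) (y : nat -> R) :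
  truncate n y = set_head (fun=> 0) (\row_(i < n) y i).
Proof.
apply/funext => j; rewrite /truncate /set_head.
by case: insubP => [i -> ij|/negbTE -> //]; rewrite mxE ij.
Qed.

Lemma truncate_rounding_cvg (X : normedModType R) (D : set (nat -> R))
    (g : (nat -> R) -> X) (s n : nat) (y : nat -> R) :
  finitely_continuous D g -> D (fun=> 0) -> (s <= n)%N ->
  g (truncate s (round_head n m y)) @[m --> \oo] --> g (truncate s y).
Proof.
move=> cg D0 sn; rewrite truncate_set_head.
under eq_fun do rewrite truncate_set_head.
have cr : (\row_(i < s) round_head n m y i)@[m --> \oo] --> (\row_(i < s) y i).
  move=> A [P yP PA].
  have : \forall m \near \oo, forall i : 'I_s, P 0 i (round_head n m y i).
    apply: filter_forall => i; rewrite /round_head (leq_trans (ltn_ord i) sn).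
    apply: (round_down_cvg (x := y i)).
    by have := yP 0 i; rewrite mxE.
  apply: filterS => m mP; apply: PA => i j.
  by rewrite ord1 mxE; exact: mP.
exact: cvg_comp cr (cg s (fun=> 0) D0 _).
Qed.

End Rounding.

(** * Summability domain and bounds on the truncations *)

Section Domain.
Context {R : realType}.
Variable alpha : nat -> R.
Hypothesis alpha0 : forall j, 0 <= alpha j.
Implicit Types (y z : nat -> R).

Lemma Uset_finite_support n z : (forall j, (n <= j)%N -> z j = 0) ->
  Uset alpha z.
Proof.
move=> z0; rewrite /Uset/=.
rewrite (@lim_near_cst _ _ _ _ _ (\sum_(0 <= j < n) (alpha j * `|z j|)%:E)%E)//.
  by rewrite sumEFin ltry.
exists n => // m /= nm; rewrite (big_cat_nat (n := n))//=.
rewrite (_ : \sum_(n <= j < m) _ = 0)%E ?adde0//.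
by rewrite big_nat big1// => j /andP[nj _]; rewrite z0// normr0 mulr0.
Qed.

Lemma Uset_truncate s y : Uset alpha (truncate s y).
Proof.
by apply: (@Uset_finite_support s) => j sj; rewrite /truncate ltnNge sj.
Qed.

Lemma measurable_Uset : measurable (Uset alpha : set (RN R)).
Proof.
rewrite -[X in measurable X]setTI; apply: measurable_lte => //.
apply: ge0_emeasurable_sum => [j y _ _|j _]; first by rewrite lee_fin mulr_ge0.
apply/measurable_EFinP; apply: measurable_funM => //.
by apply: measurableT_comp => //; exact: measurable_coordinate.
Qed.

Lemma flip_Uset j : flip j @^-1` Uset alpha = Uset alpha.
Proof.
apply/seteqP; split => y; rewrite /Uset/= /flip/=; congr (_ < _)%E;
  apply: eq_eseriesr => i _; case: (eqVneq i j) => [->|//]; by rewrite normrN.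
Qed.

Lemma partial_weight_ge0 n y : 0 <= partial_weight alpha n y.
Proof. by apply: prodr_ge0 => i _; exact: expR_ge0. Qed.

Lemma partial_weight_leS n y : partial_weight alpha n y <= partial_weight alpha n.+1 y.
Proof.
rewrite /partial_weight big_ord_recr/= ler_peMr//; first exact: partial_weight_ge0.
by rewrite -expR0 ler_expR mulr_ge0.
Qed.

Lemma ler_partial_weight n y z : (forall i, (i < n)%N -> `|y i| <= `|z i|) ->
  partial_weight alpha n y <= partial_weight alpha n z.
Proof.
move=> yz; apply: ler_prod => i _.
by rewrite expR_ge0/= ler_expR ler_wpM2l// yz.
Qed.

Lemma measurable_partial_weight n :
  measurable_fun [set: RN R] (fun y : RN R => partial_weight alpha n y).
Proof.
apply: measurable_prod => i _; apply: measurableT_comp => //.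
apply: measurable_funM => //.
by apply: measurableT_comp => //; exact: measurable_coordinate.
Qed.

Lemma exp_weight_finite_support n z : (forall j, (n <= j)%N -> z j = 0) ->
  exp_weight alpha z = (partial_weight alpha n z)%:E.
Proof.
move=> z0; rewrite /exp_weight; apply: lim_near_cst => //.
exists n => // m /= nm; congr (_%:E); rewrite -!(big_mkord xpredT
  (fun i => expR (alpha i * `|z i|))) (big_cat_nat (n := n))//=.
rewrite (_ : \prod_(n <= j < m) _ = 1) ?mulr1.
  by rewrite /partial_weight big_mkord.
by rewrite big_nat big1// => j /andP[nj _]; rewrite z0// normr0 mulr0 expR0.
Qed.

Lemma nondecreasing_partial_weight y :
  {homo (fun n => (partial_weight alpha n y)%:E) : n m / (n <= m)%N >-> (n <= m)%E}.
Proof.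
apply: homo_leq => [//|? ? ?|n]; first exact: le_trans.
by rewrite lee_fin partial_weight_leS.
Qed.

Lemma partial_weight_le_exp_weight n y :
  ((partial_weight alpha n y)%:E <= exp_weight alpha y)%E.
Proof.
have cv := ereal_nondecreasing_cvgn (@nondecreasing_partial_weight y).
have -> : exp_weight alpha y = ereal_sup (range (fun n => (partial_weight alpha n y)%:E)).
  exact/cvg_lim.
by apply: ereal_sup_ubound; exists n.
Qed.

Lemma measurable_exp_weight :
  measurable_fun [set: RN R] (exp_weight alpha : RN R -> \bar R).
Proof.
apply: (emeasurable_fun_cvg (fun n (y : RN R) => (partial_weight alpha n y)%:E)).
  by move=> n; apply/measurable_EFinP; exact: measurable_partial_weight.
move=> y _; apply: ereal_nondecreasing_is_cvgn; exact: nondecreasing_partial_weight.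
Qed.

Lemma exp_weight_ge0 y : (0 <= exp_weight alpha y)%E.
Proof.
by apply: le_trans (partial_weight_le_exp_weight 0 y); rewrite lee_fin partial_weight_ge0.
Qed.

Lemma integral_exp_weight_le (mu : {measure set (RN R) -> \bar R}) (M : R) :
  (forall n, (\int[mu]_y (partial_weight alpha n y)%:E <= M%:E)%E) ->
  (\int[mu]_y exp_weight alpha y <= M%:E)%E.
Proof.
move=> hM; rewrite monotone_convergence//.
- apply: lime_le; last by apply: nearW => n; exact: hM.
  apply: ereal_nondecreasing_is_cvgn => n m nm; apply: ge0_le_lower_integral => y _.
    by rewrite lee_fin partial_weight_ge0.
  exact: nondecreasing_partial_weight.
- by move=> n; apply/measurable_EFinP; exact: measurable_partial_weight.
- by move=> n y _; rewrite lee_fin partial_weight_ge0.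
- by move=> y _; exact: nondecreasing_partial_weight.
Qed.

End Domain.

(** The order in which a finite set lists its elements is unspecified, but a list
    of length at most one has no freedom. *)
Lemma enum_fset_nil (K : choiceType) (A : {fset K}) :
  A = fset0 -> (A : seq K) = [::].
Proof.
move=> A0; apply: perm_small_eq => //; apply: uniq_perm; rewrite ?fset_uniq//.
by move=> x; rewrite A0 !inE.
Qed.

Lemma enum_fset_single (K : choiceType) (A : {fset K}) (j : K) :
  A = [fset j]%fset -> (A : seq K) = [:: j].
Proof.
move=> Aj; apply: perm_small_eq => //; apply: uniq_perm; rewrite ?fset_uniq//.
by move=> x; rewrite Aj !inE.
Qed.

Definition pure_index (j k : nat) : multi_index := [fsfun x in [fset j]%fset => k].

Section PureIndex.
Variables (j k : nat).
Hypothesis k0 : (0 < k)%N.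

Lemma finsupp_pure_index : (finsupp (pure_index j k) : seq nat) = [:: j].
Proof.
apply: enum_fset_single; rewrite finsupp_fsfun; apply/fsetP => x.
by rewrite !inE -lt0n k0 andbT.
Qed.

Lemma pure_indexE : pure_index j k j = k.
Proof. by rewrite fsfunE inE eqxx. Qed.

Lemma mi_order_pure_index : mi_order (pure_index j k) = k.
Proof. by rewrite /mi_order finsupp_pure_index big_seq1 pure_indexE. Qed.

Lemma mi_pow_pure_index (R : realType) (b : nat -> R) :
  mi_pow b (pure_index j k) = b j ^+ k.
Proof. by rewrite /mi_pow finsupp_pure_index big_seq1 pure_indexE. Qed.

Lemma mixed_partial_pure_index (R : realType) (X : normedModType R)
    (g : (nat -> R) -> X) :
  mixed_partial (pure_index j k) g = iter k (partial j) g.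
Proof.
rewrite /mixed_partial finsupp_pure_index /= cats0 pure_indexE /iter_partial.
by elim: k => //= n ->.
Qed.

End PureIndex.

Definition zero_index : multi_index := [fsfun].

Lemma finsupp_zero_index : (finsupp zero_index : seq nat) = [::].
Proof. by apply: enum_fset_nil; rewrite finsupp0. Qed.

Section Bounds.
Context {R : realType} {X : normedModType R}.
Variables (alpha : nat -> R) (g : (nat -> R) -> X) (k : nat).
Variables (Theta : nat -> R) (b : nat -> R).
Hypotheses (alpha0 : forall j, 0 <= alpha j) (hTheta : forall m, 0 <= Theta m).
Hypothesis k1 : (1 <= k)%N.
Hypothesis hdiff : continuously_differentiable (Uset alpha) k.+1 g.
Hypothesis hbound : forall y, Uset alpha y ->
  forall nu : multi_index, (mi_order nu <= k.+1)%N ->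
    (`|mixed_partial nu g y|%:E
       <= (Theta (mi_order nu) * mi_pow b nu)%:E * exp_weight alpha y < +oo)%E.
Implicit Types (y z : nat -> R).

Lemma truncation_norm_le s y :
  `|g (truncate s y)| <= Theta 0%N * partial_weight alpha s y.
Proof.
have := hbound (Uset_truncate alpha s y) (nu := zero_index).
rewrite /mi_order /mi_pow /mixed_partial finsupp_zero_index !big_nil mulr1.
move=> /(_ isT)/andP[+ _].
rewrite (@exp_weight_finite_support _ _ s); last first.
  by move=> j sj; rewrite /truncate ltnNge sj.
rewrite -EFinM lee_fin => /le_trans; apply; rewrite ler_wpM2l//.
by apply: ler_partial_weight => // i js; rewrite /truncate js.
Qed.

Lemma pure_second_partial_norm_le j z : (forall i, (j < i)%N -> z i = 0) ->
  `|partial j (partial j g) z| <= Theta 2 * b j ^+ 2 * partial_weight alpha j.+1 z.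
Proof.
move=> z0; have Uz := Uset_finite_support (n := j.+1) alpha z0.
have := hbound Uz (nu := pure_index j 2).
rewrite mi_order_pure_index// mi_pow_pure_index// mixed_partial_pure_index//.
rewrite ltnS k1 => /(_ isT)/andP[+ _].
by rewrite (exp_weight_finite_support _ z0) -EFinM lee_fin.
Qed.

(** Along coordinate [j], the truncations at levels [j] and [j + 1] of [y] and
    of its reflection are the values at [0], [y j] and [- y j] of one function
    of a real variable. *)
Lemma second_difference_truncation_le (G : {linear X -> R^o}) (K : R) j y :
  continuous G -> 0 <= K -> (forall x, `|G x| <= K * `|x|) ->
  `|G (g (truncate j.+1 y)) + G (g (truncate j.+1 (flip j y)))
    - 2 * G (g (truncate j y))| <=
  2 * (K * Theta 2 * b j ^+ 2) * (y j ^+ 2 * partial_weight alpha j.+1 y).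
Proof.
move=> cG K0 GK.
pose z (u : R) : nat -> R := [eta truncate j y with j |-> u].
have z0 u i : (j < i)%N -> z u i = 0.
  by move=> ji; rewrite /z /= gtn_eqF// /truncate ltnNge ltnW.
have Uz u : Uset alpha (z u) := Uset_finite_support (n := j.+1) alpha (z0 u).
have zz u v : [eta z u with j |-> v] = z v :> (nat -> R).
  by apply/funext => i; rewrite /z /=; case: eqP.
have zj u : z u j = u by rewrite /z /= eqxx.
have dz (f : (nat -> R) -> X) (u : R) :
    derivable (fun t : R => f [eta z u with j |-> t]) (z u j) 1 ->
    is_derive u 1 (fun t : R => G (f (z t)) : R) (G (partial j f (z u))).
  rewrite zj => df.
  have -> : partial j f (z u) = derive1 (fun t => f (z t)) u.
    by rewrite /partial zj; congr (derive1 _ u); apply/funext => t; rewrite zz.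
  apply: is_derive_linear_comp => //.
  by move: df; congr (derivable _ u 1); apply/funext => t; rewrite zz.
have d1 (u : R) : is_derive u 1 (fun t : R => G (g (z t)) : R) (G (partial j g (z u))).
  by apply: dz; exact: (hdiff.1 [::]).
have d2 (u : R) : is_derive u 1 (fun t : R => G (partial j g (z t)) : R)
    (G (partial j (partial j g) (z u))).
  by apply: dz; exact: (hdiff.1 [:: j]).
have d2B (u : R) : `|u| <= `|y j| ->
    `|G (partial j (partial j g) (z u)) : R| <=
    K * Theta 2 * b j ^+ 2 * partial_weight alpha j.+1 y.
  move=> uy; apply: le_trans (GK _) _.
  have -> : K * Theta 2 * b j ^+ 2 * partial_weight alpha j.+1 y =
      K * (Theta 2 * b j ^+ 2 * partial_weight alpha j.+1 y) by ring.
  rewrite ler_wpM2l//.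
  apply: le_trans (pure_second_partial_norm_le (z0 u)) _.
  apply: ler_wpM2l; first by rewrite mulr_ge0 ?sqr_ge0.
  apply: ler_partial_weight => // i.
  rewrite ltnS leq_eqVlt /z /= /truncate => /predU1P[->|ij]; first by rewrite eqxx.
  by rewrite ltn_eqF// ij.
have := second_difference_le d1 d2 d2B.
rewrite (_ : z (y j) = truncate j.+1 y); last first.
  by apply/funext => i; rewrite /z /= /truncate ltnS; case: (ltngtP i j) => [| |->].
rewrite (_ : z (- y j) = truncate j.+1 (flip j y)); last first.
  by apply/funext => i; rewrite /z /= /truncate /flip /= ltnS; case: (ltngtP i j).
rewrite (_ : z 0 = truncate j y); last first.
  by apply/funext => i; rewrite /z /= /truncate; case: (ltngtP i j).
by move=> /le_trans; apply; rewrite le_eqVlt; apply/orP; left; apply/eqP; ring.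
Qed.

End Bounds.

(** * Means of the truncations and their limit *)

Section Increments.
Context {R : realType} {X : normedModType R} (beta : R).
Variable mu : probability (RN R) R.
Hypothesis hmu : is_product_beta_gauss beta mu.
Variables (alpha : nat -> R) (g : (nat -> R) -> X) (k : nat).
Variables (Theta : nat -> R) (b : nat -> R) (M : R).
Hypotheses (alpha0 : forall j, 0 <= alpha j) (hTheta : forall m, 0 <= Theta m).
Hypothesis k1 : (1 <= k)%N.
Hypothesis hdiff : continuously_differentiable (Uset alpha) k.+1 g.
Hypothesis hbound : forall y, Uset alpha y ->
  forall nu : multi_index, (mi_order nu <= k.+1)%N ->
    (`|mixed_partial nu g y|%:E
       <= (Theta (mi_order nu) * mi_pow b nu)%:E * exp_weight alpha y < +oo)%E.
Hypothesis hM : forall n, (\int[mu]_y (partial_weight alpha n y)%:E <= M%:E)%E.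
Hypothesis hM2 : forall j,
  (\int[mu]_y (((y : nat -> R) j) ^+ 2 * partial_weight alpha j.+1 y)%:E <= M%:E)%E.

Local Notation U := (Uset alpha : set (RN R)).

Let mU : measurable U. Proof. exact: measurable_Uset. Qed.

Let integral_Uset_le (f : RN R -> R) : measurable_fun setT f ->
  (forall y, 0 <= f y) ->
  (\int[mu]_(y in U) (f y)%:E <= \int[mu]_y (f y)%:E)%E.
Proof.
move=> mf f0; apply: ge0_subset_integral => //.
- exact/measurable_EFinP.
- by move=> y _; rewrite lee_fin.
Qed.

Lemma truncation_rounding_cvg (s n : nat) (y : nat -> R) : (s <= n)%N ->
  g (truncate s (round_head n m y)) @[m --> \oo] --> g (truncate s y).
Proof.
move=> sn.
have cg : finitely_continuous (Uset alpha) g := hdiff.2 [::] isT.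
have U0 : Uset alpha (fun=> 0) by exact: (@Uset_finite_support _ _ 0).
exact: (truncate_rounding_cvg cg U0 sn).
Qed.

Section functional.
Variables (G : {linear X -> R^o}) (K : R).
Hypotheses (cG : continuous G) (K0 : 0 <= K) (GK : forall x, `|G x| <= K * `|x|).

Let Gs s (y : RN R) : R := G (g (truncate s y)).

Lemma measurable_functional_truncation s : measurable_fun setT (Gs s).
Proof.
apply: (@measurable_of_rounding _ s (fun y => G (g (truncate s y)))) => y.
exact: (cvg_comp _ _ (truncation_rounding_cvg (y := y) (leqnn s)) (@cG _)).
Qed.

Lemma functional_truncation_le s y :
  `|Gs s y| <= K * Theta 0%N * partial_weight alpha s y.
Proof.
apply: le_trans (GK _) _; rewrite -mulrA ler_wpM2l//.
exact: (truncation_norm_le alpha0 hTheta hbound).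
Qed.

Lemma integrable_functional_truncation s : mu.-integrable U (EFin \o Gs s).
Proof.
have mGs := measurable_functional_truncation s.
have KT0 : 0 <= K * Theta 0%N by rewrite mulr_ge0.
apply: (integrableS measurableT) => //.
apply/integrableP; split; first exact/measurable_EFinP.
apply: (@le_lt_trans _ _ (\int[mu]_y
    ((K * Theta 0%N)%:E * (partial_weight alpha s y)%:E)))%E.
  apply: ge0_le_lower_integral => y _ //=.
  by rewrite lee_fin functional_truncation_le.
rewrite ge0_integralZl ?lee_fin//.
- apply: lte_mul_pinfty; rewrite ?lee_fin//.
  by apply: le_lt_trans (hM s) _; rewrite ltry.
- by apply/measurable_EFinP; exact: measurable_partial_weight.
- by move=> y _; rewrite lee_fin partial_weight_ge0.
Qed.

Definition mean_truncation s : R := fine (\int[mu]_(y in U) (Gs s y)%:E)%E.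

Lemma mean_truncationE s :
  (\int[mu]_(y in U) (Gs s y)%:E = (mean_truncation s)%:E)%E.
Proof.
by rewrite fineK//; apply: integrable_fin_num (integrable_functional_truncation s).
Qed.

Lemma mean_truncationB n s :
  (\int[mu]_(y in U) (Gs n y - Gs s y)%:E
   = (mean_truncation n - mean_truncation s)%:E)%E.
Proof.
under eq_integral do rewrite EFinB.
rewrite integralB ?EFinB ?mean_truncationE//;
  exact: integrable_functional_truncation.
Qed.

(** The reflection of coordinate [j] leaves the measure, the domain [U] and the
    truncation at level [j] unchanged, so twice the mean of the increment is the
    mean of the increment plus its reflection, that is, of a second
    difference. *)
Lemma mean_increment_le j :
  `|mean_truncation j.+1 - mean_truncation j| <= K * Theta 2 * M * b j ^+ 2.
Proof.
set c := K * Theta 2 * b j ^+ 2.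
have c0 : 0 <= c by rewrite /c mulr_ge0 ?sqr_ge0// mulr_ge0.
have truncF y : truncate j (flip j y) = truncate j y.
  apply/funext => i; rewrite /truncate /flip /=.
  by case: ltngtP.
(* the increment; only its first term changes under the reflection *)
pose D (y : RN R) := Gs j.+1 y - Gs j y.
have mG := measurable_functional_truncation.
have mD : measurable_fun setT D by exact: measurable_funB.
have iD : mu.-integrable U (EFin \o D).
  rewrite (_ : EFin \o D = (EFin \o Gs j.+1) \- (EFin \o Gs j))%E//.
  by apply: integrableB => //; exact: integrable_functional_truncation.
have mDF : measurable_fun setT (D \o flip j).
  by apply: measurableT_comp mD _; exact: measurable_flip.
have eF := integral_flip hmu mU (flip_Uset alpha j) mD iD.
have eI : (\int[mu]_(y in U) (D y)%:E)%E = _ := mean_truncationB j.+1 j.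
have iDF : mu.-integrable U (fun y => (D (flip j y))%:E).
  apply/integrableP; split; first by apply: measurable_funTS; exact/measurable_EFinP.
  have mnD : measurable_fun setT (fun y => `|D y|) by exact: measurableT_comp.
  have inD : mu.-integrable U (EFin \o (fun y => `|D y|)).
    exact: integrable_norm.
  have := integral_flip hmu mU (flip_Uset alpha j) mnD inD.
  under eq_integral do rewrite -abse_EFin.
  move=> ->; case/integrableP: iD => _; exact.
have key y : `|D y + D (flip j y)| <=
    2 * c * ((y : nat -> R) j ^+ 2 * partial_weight alpha j.+1 y).
  apply: le_trans (second_difference_truncation_le alpha0 hTheta k1 hdiff hbound
    j y cG K0 GK).
  rewrite le_eqVlt; apply/orP; left; apply/eqP; congr `|_|.
  by rewrite /D /Gs truncF; ring.
have mw : measurable_fun [set: RN R]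
    (fun y => (y : nat -> R) j ^+ 2 * partial_weight alpha j.+1 y).
  apply: measurable_funM; last exact: measurable_partial_weight.
  by apply: measurable_funX; exact: measurable_coordinate.
have w0 y : 0 <= (y : nat -> R) j ^+ 2 * partial_weight alpha j.+1 y.
  by rewrite mulr_ge0 ?sqr_ge0 ?partial_weight_ge0.
have twice : (`|(2 * (mean_truncation j.+1 - mean_truncation j))%:E| <=
    (2 * c)%:E * M%:E)%E.
  have -> : ((2 * (mean_truncation j.+1 - mean_truncation j))%:E =
      \int[mu]_(y in U) (D y)%:E + \int[mu]_(y in U) (D (flip j y))%:E)%E.
    by rewrite eF eI -EFinD; congr (_%:E); ring.
  rewrite -integralD//.
  apply: le_trans (le_abse_integral _ _ _) _ => //.
    by apply: emeasurable_funD; apply: measurable_funTS; exact/measurable_EFinP.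
  apply: (@le_trans _ _ (\int[mu]_(y in U)
      (2 * c * ((y : nat -> R) j ^+ 2 * partial_weight alpha j.+1 y))%:E)%E).
    apply: ge0_le_lower_integral => y _ //=.
    by rewrite lee_fin; exact: key.
  apply: le_trans (integral_Uset_le _ _) _.
  - exact: measurable_funM.
  - by move=> y; rewrite mulr_ge0// mulr_ge0.
  have cc0 : 0 <= 2 * c by rewrite mulr_ge0.
  under eq_integral do rewrite EFinM.
  rewrite ge0_integralZl ?lee_fin//.
  - by apply: lee_wpmul2l => //; rewrite lee_fin.
  - exact/measurable_EFinP.
  - by move=> y _; rewrite lee_fin.
move: twice; rewrite abse_EFin -EFinM lee_fin normrM ger0_norm// -[leRHS]mulrA.
rewrite ler_pM2l// => /le_trans; apply.
by rewrite le_eqVlt /c; apply/orP; left; apply/eqP; ring.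
Qed.

Lemma mean_tail_le s n : (s <= n)%N ->
  `|mean_truncation n - mean_truncation s| <=
  K * Theta 2 * M * \sum_(s <= j < n) b j ^+ 2.
Proof.
elim: n => [|n ih].
  by rewrite leqn0 => /eqP ->; rewrite subrr normr0 big_geq// mulr0.
rewrite leq_eqVlt => /predU1P[<-|]; first by rewrite subrr normr0 big_geq// mulr0.
rewrite ltnS => sn; rewrite big_nat_recr//= mulrDr.
apply: le_trans (lerD (ih sn) (mean_increment_le n)).
have -> : mean_truncation n.+1 - mean_truncation s =
    (mean_truncation n - mean_truncation s) +
    (mean_truncation n.+1 - mean_truncation n) by ring.
exact: ler_normD.
Qed.

End functional.
Section limit.
Variable N : set (RN R).
Hypotheses (mN : measurable N) (N0 : mu N = 0%E).
Hypothesis hlim : forall y, U y -> ~ N y ->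
  `|g y - g (truncate n y)| @[n --> \oo] --> (0 : R).

(** Off the null set [N] the truncations converge, so this modification of
    [g - g_s] is a limit of measurable functions on [U], which [g - g_s] itself
    need not be. *)
Definition tame_difference s (y : RN R) : X :=
  if `[< N y >] then 0 else g y - g (truncate s y).

Let approx s n (y : RN R) : X :=
  if `[< N y >] then 0 else g (truncate n y) - g (truncate s y).

Let approx_cvg s y : U y -> approx s n y @[n --> \oo] --> tame_difference s y.
Proof.
move=> Uy; rewrite /approx /tame_difference; case: asboolP => [_|Ny].
  exact: cvg_cst.
apply: cvgB; last exact: cvg_cst.
apply/cvgrPdist_lt => e e0.
have /cvgrPdist_lt/(_ e e0) := hlim Uy Ny.
by apply: filterS => n; rewrite sub0r normrN normr_id.
Qed.

Let measurable_approx s n (psi : X -> R) : continuous psi ->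
  measurable_fun setT (fun y => psi (approx s n y)).
Proof.
move=> cpsi.
pose Phi (y : nat -> R) := psi (g (truncate n y) - g (truncate s y)).
have mPhi : measurable_fun [set: RN R] (Phi : RN R -> R).
  apply: (@measurable_of_rounding _ (maxn s n) Phi) => y.
  have cv : (fun m => g (truncate n (round_head (maxn s n) m y)) -
        g (truncate s (round_head (maxn s n) m y))) @ \oo -->
      g (truncate n y) - g (truncate s y).
    apply: cvgB.
      exact: (truncation_rounding_cvg (y := y) (leq_maxr s n)).
    exact: (truncation_rounding_cvg (y := y) (leq_maxl s n)).
  exact: (cvg_comp _ _ cv (cpsi _)).
have -> : (fun y => psi (approx s n y)) =
    (fun y => \1_N y * psi 0 + \1_(~` N) y * Phi y).
  apply/funext => y; rewrite /approx !indicE in_setC.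
  case: asboolP => Ny; first by rewrite mem_set//= mul1r mul0r addr0.
  by rewrite memNset//= mul1r mul0r add0r.
have mNC := measurableC mN.
apply: measurable_funD; apply: measurable_funM => //; exact: measurable_indic.
Qed.

Lemma measurable_tame_difference s (psi : X -> R) : continuous psi ->
  measurable_fun U (fun y => psi (tame_difference s y)).
Proof.
move=> cpsi.
apply: (@measurable_fun_cvg _ _ _ _ (fun n y => psi (approx s n y))).
  by move=> n; apply: measurable_funTS; exact: measurable_approx.
by move=> y Uy; exact: (cvg_comp _ _ (@approx_cvg s y Uy) (cpsi _)).
Qed.

Lemma tame_difference_norm_le s y : U y ->
  (`|tame_difference s y|%:E <= (2 * Theta 0%N)%:E * exp_weight alpha y)%E.
Proof.
move=> Uy; rewrite /tame_difference.
have T0 : (0 <= (Theta 0%N)%:E)%E by rewrite lee_fin.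
have W0 := exp_weight_ge0 alpha0 y.
case: asboolP => [_|_].
  by rewrite normr0 mule_ge0// lee_fin mulr_ge0.
have gy : (`|g y|%:E <= (Theta 0%N)%:E * exp_weight alpha y)%E.
  have := hbound Uy (nu := zero_index).
  rewrite /mi_order /mi_pow /mixed_partial finsupp_zero_index !big_nil mulr1.
  by move=> /(_ isT)/andP[].
have gs : (`|g (truncate s y)|%:E <= (Theta 0%N)%:E * exp_weight alpha y)%E.
  apply: (@le_trans _ _ (Theta 0%N * partial_weight alpha s y)%:E).
    by rewrite lee_fin; exact: (truncation_norm_le alpha0 hTheta hbound).
  by rewrite EFinM lee_wpmul2l// partial_weight_le_exp_weight.
apply: (@le_trans _ _ (`|g y|%:E + `|g (truncate s y)|%:E)%E).
  by rewrite -EFinD lee_fin ler_normB.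
by rewrite mulr_natl mulr2n EFinD ge0_muleDl// leeD.
Qed.

Let integrable_exp_weight c :
  mu.-integrable U (fun y => c%:E * exp_weight alpha y)%E.
Proof.
apply: integrableZl => //; apply: (integrableS measurableT) => //.
apply/integrableP; split; first exact: measurable_exp_weight.
under eq_integral do rewrite gee0_abs ?exp_weight_ge0//.
apply: le_lt_trans (integral_exp_weight_le alpha0 hM) _; exact: ltry.
Qed.

Lemma tame_difference_integral_lty s :
  (\int[mu]_(y in U) `|tame_difference s y|%:E < +oo)%E.
Proof.
apply: (@le_lt_trans _ _
  (\int[mu]_(y in U) ((2 * Theta 0%N)%:E * exp_weight alpha y))%E).
  by apply: ge0_le_lower_integral => // y Uy; exact: tame_difference_norm_le.
have := integrable_exp_weight (2 * Theta 0%N) => /integrableP[_].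
apply: le_lt_trans; apply: ge0_le_lower_integral => y _; last exact: lee_abs.
by rewrite mule_ge0 ?exp_weight_ge0// lee_fin mulr_ge0.
Qed.

Section functional_limit.
Variables (G : {linear X -> R^o}) (K : R).
Hypotheses (cG : continuous G) (K0 : 0 <= K) (GK : forall x, `|G x| <= K * `|x|).

Lemma integrable_functional_tame s :
  mu.-integrable U (fun y => (G (tame_difference s y))%:E).
Proof.
apply: (le_integrable mU _ _ (integrable_exp_weight (K * (2 * Theta 0%N)))).
  by apply/measurable_EFinP; exact: (measurable_tame_difference s).
move=> y Uy; rewrite [leRHS]gee0_abs; last first.
  by rewrite mule_ge0 ?exp_weight_ge0// lee_fin !mulr_ge0.
rewrite abse_EFin EFinM -muleA.
apply: (@le_trans _ _ (K%:E * `|tame_difference s y|%:E)%E).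
  by rewrite -EFinM lee_fin.
by rewrite lee_wpmul2l ?lee_fin// tame_difference_norm_le.
Qed.

(** Dominated convergence; the dominating function is a multiple of the infinite
    product of the exponentials, whose integral is at most [M] by monotone
    convergence. *)
Lemma mean_truncation_cvg s :
  (fun n => (mean_truncation G n - mean_truncation G s)%:E) @ \oo -->
  (\int[mu]_(y in U) (G (tame_difference s y))%:E)%E.
Proof.
have [|||||_ _] := @dominated_convergence _ _ _ mu U mU
  (fun n y => (G (g (truncate n y)) - G (g (truncate s y)))%:E)
  (fun y => (G (tame_difference s y))%:E)
  (fun y => (2 * (K * Theta 0%N))%:E * exp_weight alpha y)%E.
- move=> n; apply: measurable_funTS; apply/measurable_EFinP.
  by apply: measurable_funB; exact: (measurable_functional_truncation cG).
- by apply/measurable_EFinP; exact: measurable_tame_difference.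
- exists N; split => // y /= /not_implyP[Uy ncv]; apply: contrapT => Ny; apply: ncv.
  apply: cvg_EFin; first exact: nearW.
  have GE : (fun n => G (g (truncate n y)) - G (g (truncate s y))) =
      (fun n => G (approx s n y)).
    by apply/funext => n; rewrite /approx asboolF// linearB.
  have cv : (fun n => G (g (truncate n y)) - G (g (truncate s y))) @ \oo -->
      (G (tame_difference s y) : R^o).
    by rewrite GE; exact: (cvg_comp _ _ (@approx_cvg s y Uy) (@cG _)).
  exact: cv.
- exact: integrable_exp_weight.
- apply: aeW => y n Uy.
  have KW m : ((K * Theta 0%N * partial_weight alpha m y)%:E <=
      (K * Theta 0%N)%:E * exp_weight alpha y)%E.
    by rewrite EFinM lee_wpmul2l ?lee_fin ?mulr_ge0// partial_weight_le_exp_weight.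
  have W0 := exp_weight_ge0 alpha0 y.
  rewrite [leRHS](_ : _ = (K * Theta 0%N)%:E * exp_weight alpha y +
      (K * Theta 0%N)%:E * exp_weight alpha y)%E; last first.
    by rewrite mulr_natl mulr2n EFinD ge0_muleDl ?lee_fin ?mulr_ge0.
  apply: le_trans (leeD (KW n) (KW s)); rewrite abse_EFin -EFinD lee_fin.
  apply: le_trans (ler_normB _ _) _.
  by apply: lerD; exact: (functional_truncation_le K0 GK).
under eq_fun do rewrite (mean_truncationB cG K0 GK).
exact.
Qed.

Lemma functional_tame_le s B :
  (forall n, (s <= n)%N -> \sum_(s <= j < n) b j ^+ 2 <= B) -> 0 <= M ->
  (`|\int[mu]_(y in U) (G (tame_difference s y))%:E|
    <= (K * Theta 2 * M * B)%:E)%E.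
Proof.
move=> hB M0; have cv := cvg_abse (@mean_truncation_cvg s).
apply: (cvge_to_le (cv _)); exists s => // n /= sn.
rewrite lee_fin; apply: le_trans (mean_tail_le cG K0 GK sn) _.
by rewrite ler_wpM2l ?hB// !mulr_ge0.
Qed.

End functional_limit.
End limit.
End Increments.

(** * Dimension truncation *)

Theorem theorem4p1 (R : realType) (beta : R) (hbeta : 1 <= beta)
    (X : completeNormedModType R) (hX : separable X)
    (mu : probability (RN R) R) (hmu : is_product_beta_gauss beta mu)
    (alpha : nat -> R) (halpha0 : forall j, 0 <= alpha j)
    (halpha1 : in_ell 1 alpha)
    (g : (nat -> R) -> X)
    (p : R) (hp : 0 < p < 1)
    (k : nat) (hk : k%:Z = Num.ceil (1 / (1 - p)))
    (hlim : {ae mu, forall y, Uset alpha y ->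
               `|g y - g (truncate s y)| @[s --> \oo] --> (0 : R)})
    (Theta : nat -> R) (hTheta : forall m, 0 <= Theta m)
    (b : nat -> R) (hb : in_ell p b)
    (hb_mono : nonincreasing_seq b) (hb0 : forall j, 0 <= b j)
    (hdiff : continuously_differentiable (Uset alpha) k.+1 g)
    (hbound : forall y, Uset alpha y ->
       forall nu : multi_index, (mi_order nu <= k.+1)%N ->
       (`|mixed_partial nu g y|%:E
          <= (Theta (mi_order nu) * mi_pow b nu)%:E * exp_weight alpha y
          < +oo)%E)
    (hbeta1 : beta = 1 -> forall j, alpha j < 1) :
  exists C : R, [/\ 0 < C,
    forall s : nat, (0 < s)%N ->
      bochner_integrable mu (Uset alpha) (fun y => g y - g (truncate s y)) /\
      `|bochner_integral mu (Uset alpha) (fun y => g y - g (truncate s y))|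
        <= C * s%:R `^ (- (2 / p) + 1) &
    forall G : {linear X -> R^o}, continuous G ->
      forall s : nat, (0 < s)%N ->
        (`| \int[mu]_(y in Uset alpha) (G (g y - g (truncate s y)))%:E |
          <= (C * dual_norm G * s%:R `^ (- (2 / p) + 1))%:E)%E].
Proof.
have k1 : (1 <= k)%N.
  have : 0 < k%:Z by rewrite hk ceil_gt0 divr_gt0// subr_gt0; case/andP: hp.
  by case: k {hk hdiff hbound}.
have [M [M0 hM hM2]] := partial_weight_moments hmu hbeta halpha0 halpha1 hbeta1.
have [T T0 hT] := tail_sum_sq_le hp hb0 hb_mono hb.
case: hlim => N [mN N0 subN].
have lim0 y : Uset alpha y -> ~ N y ->
    `|g y - g (truncate n y)| @[n --> \oo] --> (0 : R).
  by move=> Uy Ny; apply: contrapT => ncv; apply/Ny/subN => /= /(_ Uy).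
have mU : measurable (Uset alpha : set (RN R)) by exact: measurable_Uset.
pose rate (s : nat) : R := s%:R `^ (- (2 / p) + 1).
have rate0 s : 0 <= rate s by exact: powR_ge0.
pose c := Theta 2 * M * T.
have c0 : 0 <= c by rewrite !mulr_ge0.
pose tame s := tame_difference g N s.
have tameE s y : ~ N y -> g y - g (truncate s y) = tame s y.
  by move=> Ny; rewrite /tame /tame_difference asboolF.
have functional_le (G : {linear X -> R^o}) (K : R) s : continuous G -> 0 <= K ->
    (forall x, `|G x| <= K * `|x|) -> (0 < s)%N ->
    (`|\int[mu]_(y in Uset alpha) (G (tame s y))%:E| <= (K * c * rate s)%:E)%E.
  move=> cG K0 GK s0.
  have := functional_tame_le hmu halpha0 hTheta k1 hdiff hbound hM hM2 mN N0 lim0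
    cG K0 GK (fun n _ => hT s n s0) M0.
  by move=> /le_trans; apply; rewrite lee_fin /c !mulrA.
have rate_le (K : R) s : 0 <= K -> K * c * rate s <= (1 + c) * K * rate s.
  move=> K0; rewrite ler_wpM2r// mulrC ler_wpM2r// lerDr//.
exists (1 + c); split; first by rewrite ltr_wpDr.
- move=> s s0.
  have [w Iw] : bochner_integrable mu (Uset alpha) (tame s).
    apply: separable_bochner_integrable => //.
      move=> x; apply: (measurable_tame_difference hdiff mN lim0 s
        (psi := fun z => `|z - x|)).
      move=> z; apply: cvg_norm; apply: cvgB; [exact: cvg_id|exact: cvg_cst].
    exact: (tame_difference_integral_lty halpha0 hTheta hbound hM N s).
  have intg : bochner_integrable mu (Uset alpha) (fun y => g y - g (truncate s y)).
    exists w; apply: (has_bochner_integral_off_null mN N0 _ Iw) => y _ Ny.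
    by rewrite tameE.
  split=> //.
  set v := bochner_integral _ _ _.
  have Iv : has_bochner_integral mu (Uset alpha) (tame s) v.
    apply: (has_bochner_integral_off_null mN N0 (fun y _ => @tameE s y)).
    by case: intg => v' Iv'; apply: (xgetPex _ (ex_intro _ v' Iv')).
  have [G [cG Gle Gv]] := exists_norming_functional v.
  have G1 x : `|G x| <= 1 * `|x| by rewrite mul1r.
  have iG := integrable_functional_tame halpha0 hTheta hdiff hbound hM mN lim0
    cG ler01 G1 s.
  have := functional_le G 1 s cG ler01 G1 s0.
  rewrite (integral_linear_bochner mU Gle iG Iv) Gv abse_EFin lee_fin normr_id.
  by move=> /le_trans; apply; rewrite -[1 + c]mulr1 rate_le.
move=> G cG s s0.
rewrite (eq_integral_off_null mN N0 (f2 := fun y => (G (tame s y))%:E)); last first.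
  by move=> y _ Ny; rewrite tameE.
apply: le_trans (functional_le G _ s cG (dual_norm_ge0 cG) (dual_norm_le cG) s0) _.
by rewrite lee_fin rate_le// dual_norm_ge0.
Qed.
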